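(* In Case A ($t,t_N$ algebraically independent), for all $\alpha\le\beta$ in $\mathcal P_N=\{1,2\}^N$, $$Q^{A,I,+}_{\alpha,\beta}=R^A_{\alpha,\beta}.$$
   Context: Order: $\alpha\le\beta$ iff every prefix of $\alpha$ contains at least as many $1$'s as the prefix of $\beta$ of the same length. $\|\alpha\|$ is the length of a string and $\|\alpha\|_\sigma$ the number of letters $\sigma$ in it. Generating function $Q^{A,I,+}$. A string $\alpha$ is identified with the lattice path from $(0,0)$ whose $i$-th step is $(1,1)$ if $\alpha_i=1$ and $(1,-1)$ if $\alpha_i=2$; $\alpha\le\beta$ iff path $\alpha$ is weakly above path $\beta$. A box $(i,j)$ is the 45-degree rotated square centred at $(i,j)$ with vertices $(i\pm1,j),(i,j\pm1)$. $\lambda^+(\alpha)$ is the set of boxes $(i,j)$ with $0<i\le N$, $|j|\le i$, $i+j-1$ even, above the path $\alpha$. The region for $\alpha\le\beta$ is $\lambda^+(\beta)/\lambda^+(\alpha)$; its boxes $(N,j)$ are anchor boxes. The box just below $(x,y)$ is $(x,y-2)$. A ballot path of length $(l,l')\in\mathbb N^2$ is a path with steps $(1,\pm1)$ from some $(x,y)$ to $(x+2l+l',y+l')$ staying weakly above height $y$; a ballot strip of length $(l,l')$ is the set of boxes centred at its vertices. $\mathrm{Conf}^{I}(\alpha,\beta)$ is the set of partitions of the boxes of the region into ballot strips such that: (Rule 0) the rightmost box of a strip with $l'\ge1$ is an anchor box; (Rule Ia) for strips $\mathcal D,\mathcal D'$, if some box of $\mathcal D$ is just below a box of $\mathcal D'$,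 then all boxes just below a box of $\mathcal D'$ belong to $\mathcal D$. A strip of length $(l,l')$ has weight $t^{2l+l'}$ if $l'$ is even and $-t^{2l+l'-1}t_N^2$ if $l'$ is odd. $Q^{A,I,+}_{\alpha,\beta}$ is the sum over $\mathrm{Conf}^I(\alpha,\beta)$ of the product of the weights of the strips ($Q^{A,I,+}_{\alpha,\alpha}=1$). Binary tree. Let $\mathcal Z$ be the smallest set of strings containing $\emptyset$, closed under concatenation and under $z\mapsto1z2$. Any string is a concatenation of elements of $\mathcal Z$ with unpaired $2$'s followed by unpaired $1$'s (i.e. $1$ and $2$ are matched as opening and closing parentheses). The $(2i-1)$-th (resp. $2i$-th) unpaired $1$ from the right is o-unpaired (resp. e-unpaired). The rooted tree $A(\alpha)$ is defined recursively: $A(\emptyset)$ is the empty tree; $A(2w)=A(w)$ (unpaired $2$); $A(zw)$ for $z\in\mathcal Z$ is obtained by attaching $A(z)$ and $A(w)$ at their roots; $A(1z2)$, $z\in\mathcal Z$, is obtained by attaching an edge just above (the root of) $A(z)$; if the first $1$ of $1w$ is e-unpaired (resp. o-unpaired), $A(1w)$ is obtained by attaching an edge just above $A(w)$ and marking this edge ''e'' (resp. ''o''). Thus leaves of $A(\beta)$ correspond to adjacent pairs $12$ in $\beta$ and to the last letter of $\beta$ if it is a $1$. Capacities. Let $\alpha\le\beta$ have the same length. If $\beta=\beta'12\beta''$ and $\alpha=\alpha'vw\alpha''$ with $\|\alpha'\|=\|\beta'\|$, $v,w\in\{1,2\}$, the leaf edge of this $12$ has capacity $\|\alpha'v\|_1-\|\beta'1\|_1$.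 If $\beta$ ends with $1$, the corresponding leaf edge has capacity $\|\alpha\|_1-\|\beta\|_1$. $A(\beta/\alpha)$ is $A(\beta)$ equipped with these capacities. A labelling of $A(\beta/\alpha)$ assigns a non-negative integer to each edge such that the integer on an edge connected to a leaf is at most its capacity, and integers are non-increasing along paths from leaves to the root. $R^A_{\alpha,\beta}=\sum_\nu t^{2\sigma}(-t_N^2)^{\sigma_o}(-t^2/t_N^2)^{\sigma_e}$, summed over all labellings $\nu$ of $A(\beta/\alpha)$, where $\sigma,\sigma_e,\sigma_o$ are the sums of the labels on the edges without mark, marked ''e'', marked ''o'', respectively. *)

(* Defs.v *)
From HB Require Import structures.
From mathcomp Require Import all_boot all_order all_algebra.

Set Implicit Arguments.
Unset Strict Implicit.
Unset Printing Implicit Defensive.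

Import GRing.Theory Num.Theory.
Local Open Scope ring_scope.

(* Strings over {1,2} are boolean sequences: [true] is the letter 1 (an up
   step, an opening parenthesis), [false] is the letter 2 (a down step, a
   closing parenthesis). *)
Definition ones (w : seq bool) : nat := count_mem true w.
Definition twos (w : seq bool) : nat := count_mem false w.

Definition str_le N (alpha beta : N.-tuple bool) : bool :=
  [forall k : 'I_N.+1, (ones (take k beta) <= ones (take k alpha))%N].

(* Only injectivity of evaluation on Z[X,Y] is required; independence over any
   larger ring of constants implies it. *)
Definition alg_indep (F : fieldType) (x y : F) : Prop :=
  forall p : {poly {poly int}},
    (map_poly (map_poly (intr : int -> F)) p).[x%:P].[y] = 0 -> p = 0.

Definition height (w : seq bool) (i : nat) : int :=
  (ones (take i w))%:Z - (twos (take i w))%:Z.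

(* The pair (i, k) encodes the box centred at (i, k - N), which covers all the
   centres (i, j) with 0 <= i <= N and |j| <= N. *)
Definition box (N : nat) : finType := ('I_N.+1 * 'I_(N.*2.+1))%type.

Section Strips.
Variable N : nat.
Implicit Types (b : box N) (D : {set box N}) (C : {set {set box N}}).
Implicit Types (alpha beta : N.-tuple bool).

Definition col b : nat := b.1.
Definition row b : int := (b.2 : nat)%:Z - N%:Z.

(* "Above the path": the bottom vertex (i, j - 1) of the box is weakly above
   the path; the left and right vertices then are as well. *)
Definition lambda alpha : {set box N} :=
  [set b | [&& (0 < col b)%N,
               `|row b| <= (col b)%:Z,
               (2 %| (col b)%:Z + row b - 1)%Z
             & height alpha (col b) <= row b - 1]].

Definition region alpha beta : {set box N} := lambda beta :\: lambda alpha.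

Definition just_below b b' : bool :=
  (col b == col b') && (row b == row b' - 2).

Definition step b b' : bool :=
  (col b' == (col b).+1) && ((row b' == row b + 1) || (row b' == row b - 1)).

(* The horizontal displacement of the path is the size of [p], 2l + l'. *)
Definition ballot_path (l l' : nat) b (p : (2 * l + l').-tuple (box N)) : bool :=
  [&& path step b p, all (fun b' => row b <= row b') p
    & row (last b p) == row b + l'%:Z].

Definition ballot_strip (l l' : nat) D : bool :=
  [exists b : box N, exists p : (2 * l + l').-tuple (box N),
     ballot_path b p && (D == [set b' in b :: p])].

Definition rule0 C : bool :=
  [forall D in C, forall l : 'I_N.+1, forall l' : 'I_N.+1,
     ballot_strip l l' D && (0 < l')%N ==>
     [forall b in D, [forall b' in D, (col b' <= col b)%N] ==> (col b == N)]].

(* The box just below a box of D' has to exist in the region and belong to D;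
   a box lying below the lower path breaks the rule. *)
Definition rule_Ia C : bool :=
  [forall D in C, forall D' in C,
     [exists b in D, exists b' in D', just_below b b'] ==>
     [forall b' in D', exists b in D, just_below b b']].

Definition Conf alpha beta : {set {set {set box N}}} :=
  [set C | [&& partition C (region alpha beta),
               [forall D in C, exists l : 'I_N.+1, exists l' : 'I_N.+1,
                  ballot_strip l l' D],
               rule0 C & rule_Ia C]].

Variables (F : fieldType) (t tN : F).

Definition length_weight (l l' : nat) : F :=
  if odd l' then - t ^+ (2 * l + l' - 1) * tN ^+ 2 else t ^+ (2 * l + l').

(* A strip has exactly one length (see [ballot_strip_inj] below). *)
Definition strip_weight D : F :=
  if [pick ll : 'I_N.+1 * 'I_N.+1 | ballot_strip ll.1 ll.2 D] is Some ll
  then length_weight ll.1 ll.2 else 0.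

Definition QA alpha beta : F :=
  \sum_(C in Conf alpha beta) \prod_(D in C) strip_weight D.

End Strips.

Inductive balanced : seq bool -> Prop :=
| balanced_nil : balanced [::]
| balanced_cat z z' : balanced z -> balanced z' -> balanced (z ++ z')
| balanced_wrap z : balanced z -> balanced (true :: z ++ [:: false]).

Inductive mark := plain | emark | omark.

Scheme Equality for mark.
HB.instance Definition _ := hasDecEq.Build mark (compareP mark_eq_dec).

(* Rooted trees whose edges carry a mark and a tag in [X].  [Edge m x a b] is
   the tree obtained by attaching, at the root of [b], an edge (m, x) with [a]
   above it; attaching is commutative, and the order in which the edges at a
   vertex are listed plays no role below. *)
Inductive rtree (X : Type) : Type :=
| Root
| Edge of mark & X & rtree X & rtree X.
Arguments Root {X}.

Section Trees.
Variable X : Type.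

Fixpoint glue (a b : rtree X) : rtree X :=
  if a is Edge m x a1 a2 then Edge m x a1 (glue a2 b) else b.

Fixpoint edges (a : rtree X) : seq (mark * X) :=
  if a is Edge m x a1 a2 then (m, x) :: edges a1 ++ edges a2 else [::].

Fixpoint root_tags (a : rtree X) : seq X :=
  if a is Edge _ x _ a2 then x :: root_tags a2 else [::].

(* Index in [w] of the 2 that closes a 1 placed just before [w], i.e. the size
   of the balanced z such that w = z 2 w'; it is [size w] if that 1 is
   unpaired. *)
Definition closing (w : seq bool) : nat :=
  find (fun m => ones (take m.+1 w) < twos (take m.+1 w))%N (iota 0 (size w)).

Fixpoint unpaired_ones (w : seq bool) : nat :=
  if w is c :: w' then
    ((c && (closing w' == size w')) + unpaired_ones w')%N
  else 0%N.

(* Letters come with a tag; the edge created by a letter 1 inherits its tag.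
   [n] is fuel, [size w] being enough.  The three branches are A(2w) = A(w),
   A(1z2w) with z balanced, and A(1w) with an unpaired 1, whose rank from the
   right among the unpaired 1's is [unpaired_ones] of the string it heads; see
   [tree_two], [tree_cat], [tree_pair] and [tree_unpaired]. *)
Fixpoint tree_rec (n : nat) (w : seq (X * bool)) : rtree X :=
  if n is n'.+1 then
    match w with
    | [::] => Root
    | (_, false) :: w' => tree_rec n' w'
    | (x, true) :: w' =>
        let k := closing (unzip2 w') in
        if (k < size w')%N then
          Edge plain x (tree_rec n' (take k w')) (tree_rec n' (drop k.+1 w'))
        else
          Edge (if odd (unpaired_ones (unzip2 w)) then omark else emark) x
               (tree_rec n' w') Root
    end
  else Root.

Definition tree (w : seq (X * bool)) : rtree X := tree_rec (size w) w.

Fixpoint is_labelling (cap nu : X -> nat) (a : rtree X) : bool :=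
  if a is Edge _ x a1 a2 then
    [&& (if a1 is Root then (nu x <= cap x)%N
         else all (fun y => nu x <= nu y)%N (root_tags a1)),
        is_labelling cap nu a1 & is_labelling cap nu a2]
  else true.

End Trees.

Section Labellings.
Variable N : nat.
Implicit Types (alpha beta : N.-tuple bool).

Definition treeA beta : rtree 'I_N := tree [seq (i, tnth beta i) | i <- enum 'I_N].

(* The capacity of a leaf edge created by the 1 at position p (from 0): for an
   adjacent pair 12 the prefixes alpha'v and beta'1 have size p + 1; for a final
   1, p + 1 = N and the prefixes are alpha and beta.  The subtraction does not
   truncate when alpha <= beta. *)
Definition capacity alpha beta (p : 'I_N) : nat :=
  (ones (take p.+1 alpha) - ones (take p.+1 beta))%N.

(* A labelling is a function on positions which is 0 off the edges.  Labels are
   at most the capacity of some leaf, hence at most N, so the codomain 'I_N.+1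
   loses nothing. *)
Definition labellings alpha beta : {set {ffun 'I_N -> 'I_N.+1}} :=
  [set nu : {ffun 'I_N -> 'I_N.+1} |
     is_labelling (capacity alpha beta) (fun p => nu p) (treeA beta)
     && [forall p, (p \in unzip2 (edges (treeA beta))) || (nu p == ord0)]].

Definition label_sum beta (nu : {ffun 'I_N -> 'I_N.+1}) (m : mark) : nat :=
  (\sum_(e <- edges (treeA beta) | e.1 == m) nu e.2)%N.

Definition RA (F : fieldType) (t tN : F) alpha beta : F :=
  \sum_(nu in labellings alpha beta)
     t ^+ (2 * label_sum beta nu plain)
     * (- tN ^+ 2) ^+ label_sum beta nu omark
     * (- (t ^+ 2 / tN ^+ 2)) ^+ label_sum beta nu emark.

End Labellings.

Lemma step_col N (b : box N) p : path (@step N) b p ->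
  forall k, (k <= size p)%N -> col (nth b (b :: p) k) = (col b + k)%N.
Proof.
elim: p b => [|c p IH] b /=; first by move=> _ [|k] //= _; rewrite addn0.
case/andP=> /andP[/eqP cb _] pp [|k] /= lk; first by rewrite addn0.
by rewrite (set_nth_default c) //= IH // cb addnS addSn.
Qed.

Lemma ballot_strip_inj N (l l' m m' : nat) (D : {set box N}) :
  ballot_strip l l' D -> ballot_strip m m' D -> l = m /\ l' = m'.
Proof.
have key (k k' : nat) : ballot_strip k k' D -> exists b b' : box N,
  [/\ b \in D, b' \in D, {in D, forall c, (col b <= col c <= col b')%N},
      {in D &, injective (@col N)}
    & (col b' = col b + (2 * k + k'))%N /\ row b' = row b + k'%:Z].
  case/existsP=> b /existsP[p /andP[/and3P[pp _ /eqP rl] /eqP ->]].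
  have sp := size_tuple p; have cE := step_col pp; rewrite sp in cE.
  have lE : last b p = nth b (b :: p) (2 * k + k') by rewrite (last_nth b) sp.
  exists b, (last b p); split.
  - by rewrite inE mem_head.
  - by rewrite inE mem_last.
  - move=> c; rewrite inE => /(nthP b)[i]; rewrite /= ltnS sp => li <-.
    by rewrite lE !cE // leq_addr leq_add2l.
  - move=> c c'; rewrite !in_set.
    case/(nthP b)=> i; rewrite /= ltnS sp => li <-.
    case/(nthP b)=> j; rewrite /= ltnS sp => lj <-.
    by rewrite !cE // => /addnI ->.
  - by rewrite lE cE // -lE.
case/key=> b [b' [bD b'D minD injD [cE rE]]].
case/key=> d [d' [dD d'D minD' _ [cE' rE']]].
have Eb : b = d.
  apply: injD => //; apply/eqP; rewrite eqn_leq.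
  by have/andP[-> _] := minD _ dD; have/andP[-> _] := minD' _ bD.
have Eb' : b' = d'.
  apply: injD => //; apply/eqP; rewrite eqn_leq.
  by have/andP[_ ->] := minD _ d'D; have/andP[_ ->] := minD' _ b'D.
subst d d'; have El : l' = m' by move: rE'; rewrite rE => /addrI [].
by move: cE'; rewrite cE El => /addnI /addIn /eqP; rewrite eqn_pmul2l // => /eqP.
Qed.

Lemma balanced_prefix z : balanced z ->
  ones z = twos z /\ forall k, (twos (take k z) <= ones (take k z))%N.
Proof.
rewrite /ones /twos.
elim=> [|z1 z2 _ [e1 p1] _ [e2 p2]|z1 _ [e1 p1]]; first by split=> // -[].
  split=> [|k]; first by rewrite !count_cat e1 e2.
  by rewrite take_cat; case: ifP => // _; rewrite !count_cat e1 leq_add.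
split=> [|k].
  by rewrite /= !count_cat /= e1 !addn0 add0n addnC.
case: k => [|k] /=; first by [].
rewrite take_cat; case: ifP => _; first by rewrite add0n add1n leqW.
rewrite !count_cat e1; case: (k - _)%N => [|n] /=.
  by rewrite !addn0 add0n add1n.
by case: n => [|n] /=; rewrite !addn0 add0n addn1 add1n.
Qed.

Lemma closing_balanced z w : balanced z -> closing (z ++ false :: w) = size z.
Proof.
case/balanced_prefix=> ez pz; rewrite /closing size_cat iotaD find_cat add0n.
case: hasP => [[m]|_].
  rewrite mem_iota add0n => /andP[_ lm].
  have -> : take m.+1 (z ++ false :: w) = take m.+1 z by rewrite takel_cat.
  by rewrite ltnNge pz.
rewrite size_iota /=.
have -> : take (size z).+1 (z ++ false :: w) = z ++ [:: false].
  by rewrite -cat_rcons take_size_cat ?size_rcons // cats1.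
move: ez; rewrite /ones /twos !count_cat /= => ->.
by rewrite !addn0 addn1 leqnn addn0.
Qed.

Section TreeEquations.
Variable X : Type.
Implicit Types (w z : seq (X * bool)) (x y : X).

Lemma tree_rec_fuel n n' w :
  (size w <= n)%N -> (size w <= n')%N -> tree_rec n w = tree_rec n' w.
Proof.
elim: n n' w => [|n IH] [|n'] [|[x []] w] //=; rewrite !ltnS => l l'.
  have lt k : (size (take k w) <= size w)%N by rewrite size_take_min geq_minr.
  have ld k : (size (drop k w) <= size w)%N by rewrite size_drop leq_subr.
  by case: ifP => _; congr Edge; apply: IH;
    rewrite ?(leq_trans (lt _)) ?(leq_trans (ld _)).
exact: IH.
Qed.

Lemma tree_nil : tree [::] = Root :> rtree X.
Proof. by []. Qed.

Lemma tree_two x w : tree ((x, false) :: w) = tree w.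
Proof. by []. Qed.

Lemma tree_pair x y z w : balanced (unzip2 z) ->
  tree ((x, true) :: z ++ (y, false) :: w) = Edge plain x (tree z) (tree w).
Proof.
move=> bz; rewrite /tree /= /unzip2 map_cat /= closing_balanced // size_map.
rewrite size_cat /= addnS ltnS leq_addr take_size_cat //.
rewrite -cat_rcons drop_size_cat ?size_rcons //.
by congr Edge; apply: tree_rec_fuel; rewrite // leqW // ?leq_addr ?leq_addl.
Qed.

Lemma glueA : associative (@glue X).
Proof. by move=> a b c; elim: a => //= m x a1 _ a2 ->. Qed.

Lemma tree_cat z w : balanced (unzip2 z) ->
  tree (z ++ w) = glue (tree z) (tree w).
Proof.
move: {2}(unzip2 z) (erefl (unzip2 z)) => u uE; rewrite uE => bu.
elim: bu z w uE => [|u1 u2 _ IH1 _ IH2|u1 bu _] z w.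
- by case: z.
- move=> uE; rewrite -(cat_take_drop (size u1) z) -catA.
  have E1 : unzip2 (take (size u1) z) = u1.
    by rewrite /unzip2 map_take -/(unzip2 z) uE take_size_cat.
  have E2 : unzip2 (drop (size u1) z) = u2.
    by rewrite /unzip2 map_drop -/(unzip2 z) uE drop_size_cat.
  by rewrite (IH1 _ _ E1) (IH2 _ _ E2) (IH1 _ _ E1) glueA.
case: z => [|[x c] z] //= [-> ]; case/lastP: z => [|z [y d]].
  by move/(congr1 size); rewrite size_cat addn1.
rewrite cats1 /unzip2 map_rcons => /rcons_inj[zE ->].
have bz : balanced (unzip2 z) by rewrite /unzip2 zE.
by rewrite cat_rcons tree_pair // -cats1 tree_pair.
Qed.

Lemma tree_unpaired x w : closing (unzip2 w) = size w ->
  tree ((x, true) :: w) =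
  Edge (if odd (unpaired_ones (true :: unzip2 w)) then omark else emark)
       x (tree w) Root.
Proof. by move=> cw; rewrite /tree /= cw ltnn. Qed.

End TreeEquations.

(* Main.v *)
(* The region between beta and alpha consists of layers, layer k being the path
   beta raised by 2k + 1, restricted to the columns where alpha is more than k
   boxes above beta.  Rule Ia forces every strip to lie in a single layer and
   to rest on a strip of the layer below.  Hence a configuration amounts to
   choosing, for each layer, the steps of beta inside its strips; these sets
   decrease with the layer.  A run of steps is admissible (ballot, and unbalanced
   only at the right end) iff with each 1 it contains everything up to the
   matching 2, or up to the end if this 1 is unpaired.  So labelling each 1 with
   the number of layers in which it is used gives a labelling of the tree that
   is non-increasing towards the root, and conversely.  The distance between the
   two paths is locally minimal at the peaks of beta, so the columns of a strip
   are available iff the capacities at the leaves are respected.  Weights agree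
   because consecutive o- and e-marked edges multiply to t^2. *)
Require Import Defs.
From mathcomp Require Import all_boot all_order all_algebra.
From mathcomp Require Import zify.
(* [row] and [col] must not be those of matrix.v. *)
Import Defs.

Set Implicit Arguments.
Unset Strict Implicit.
Unset Printing Implicit Defensive.

Import GRing.Theory Num.Theory.
Local Open Scope ring_scope.

(** * Matching of parentheses *)

Lemma ones_cons c w : ones (c :: w) = (c + ones w)%N.
Proof. by rewrite /ones /= eqb_id. Qed.

Lemma twos_cons c w : twos (c :: w) = (~~ c + twos w)%N.
Proof. by case: c. Qed.

Lemma ones_twos w : (ones w + twos w)%N = size w.
Proof. by elim: w => // c w IH; rewrite ones_cons twos_cons /= -IH; case: c; lia. Qed.

Lemma ones_cat u v : ones (u ++ v) = (ones u + ones v)%N.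
Proof. exact: count_cat. Qed.

Lemma twos_cat u v : twos (u ++ v) = (twos u + twos v)%N.
Proof. exact: count_cat. Qed.

Lemma closing_le w : (closing w <= size w)%N.
Proof. by rewrite /closing -[leqRHS](size_iota 0) find_size. Qed.

(** Frees later arguments from [find]: since the search stops at the first prefix with more 2's than
    1's, bounds on [closing] become ballot conditions on prefixes. *)
Lemma leq_closingP w m : (m <= size w)%N ->
  reflect (forall i, (i <= m)%N -> (twos (take i w) <= ones (take i w))%N)
          (m <= closing w)%N.
Proof.
move=> lm; apply: (iffP idP) => [mc [|i] im|H]; first by rewrite take0.
  have /negbT := before_find 0%N (leq_trans im mc).
  by rewrite nth_iota ?add0n ?(leq_trans im) // -leqNgt.
rewrite leqNgt; apply/negP=> cm.
have cs : (closing w < size w)%N by exact: leq_trans cm lm.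
have hc : has (fun m => ones (take m.+1 w) < twos (take m.+1 w))%N (iota 0 (size w)).
  by rewrite has_find size_iota.
have := nth_find 0%N hc; rewrite -/(closing w) nth_iota // add0n.
by rewrite ltnNge H.
Qed.

Lemma closing_lt w : (closing w < size w)%N ->
  ones (take (closing w) w) = twos (take (closing w) w) /\ nth true w (closing w) = false.
Proof.
move=> cs; have le := elimT (leq_closingP (closing_le w)) (leqnn _).
have E : take (closing w).+1 w = rcons (take (closing w) w) (nth true w (closing w)).
  exact: take_nth.
have lt : (ones (take (closing w).+1 w) < twos (take (closing w).+1 w))%N.
  rewrite ltnNge; apply/negP=> lt; suff: (closing w < closing w)%N by rewrite ltnn.
  apply/(leq_closingP cs) => i; rewrite leq_eqVlt ltnS => /predU1P[->//|/le //].
move: (le _ (leqnn _)) lt; rewrite E -cats1 ones_cat twos_cat ones_cons twos_cons.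
rewrite -[ones [::]]/0%N -[twos [::]]/0%N.
by case: nth => /=; lia.
Qed.

(** A 1 put in front closes with the first unpaired 2, if any; the truncated predecessor covers the
    case of none. *)
Fixpoint unpaired_twos (w : seq bool) : nat :=
  if w is c :: w' then
    if c then (unpaired_twos w').-1 else (unpaired_twos w').+1
  else 0%N.

Lemma unpaired_twos_leP w c :
  (unpaired_twos w <= c)%N <->
  forall i, (twos (take i w) <= ones (take i w) + c)%N.
Proof.
elim: w c => [|x w IH] c /=; first by split=> // _ [].
have E k : twos (take k.+1 (x :: w)) = (~~ x + twos (take k w))%N by rewrite twos_cons.
have E' k : ones (take k.+1 (x :: w)) = (x + ones (take k w))%N by rewrite ones_cons.
split=> [H [//|i]|H].
  rewrite E E'; case: x H {E E'} => H.
    by have := (IH c.+1).1 _ i; lia.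
  by case: c H => // c H; have := (IH c).1 H i; lia.
case: x H E E' => H E E'.
  suff : (unpaired_twos w <= c.+1)%N by lia.
  by apply/IH => i; have := H i.+1; rewrite E E'; lia.
case: c H => [|c] H; first by have := H 1%N; rewrite E E' take0.
by apply/IH => i; have := H i.+1; rewrite E E'; lia.
Qed.

Lemma closing_size w : (closing w == size w) = (unpaired_twos w == 0)%N.
Proof.
rewrite eqn_leq closing_le -leqn0; apply/leq_closingP/idP => // [H|].
  apply/unpaired_twos_leP => i; rewrite addn0.
  case: (leqP i (size w)) => [/H //|lt]; rewrite take_oversize ?(ltnW lt) //.
  by have := H _ (leqnn _); rewrite take_size.
by move/unpaired_twos_leP=> H i _; have := H i; rewrite addn0.
Qed.

(** Both [ones w - unpaired_ones w] and [twos w - unpaired_twos w] count the matched pairs. *)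
Lemma unpaired_ones_twos w :
  (unpaired_ones w + twos w = ones w + unpaired_twos w)%N.
Proof.
elim: w => // x w; rewrite ones_cons twos_cons /= closing_size.
by case: x => /=; case: (unpaired_twos w) => [|n] /=; lia.
Qed.

Lemma unpaired_twos_take w k : (k <= closing w)%N -> unpaired_twos (take k w) = 0%N.
Proof.
move=> kc; apply/eqP; rewrite -leqn0; apply/unpaired_twos_leP=> i; rewrite addn0.
rewrite -take_min; apply: (elimT (leq_closingP (closing_le w)) (leqnn _)).
by rewrite (leq_trans (geq_minr _ _)).
Qed.

Lemma unpaired_ones_take w : (closing w < size w)%N ->
  unpaired_ones (take (closing w) w) = 0%N.
Proof.
move=> cs; have [E _] := closing_lt cs.
by have := unpaired_ones_twos (take (closing w) w); rewrite unpaired_twos_take //; lia.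
Qed.

Lemma closing_cat u v : (closing u < size u)%N -> closing (u ++ v) = closing u.
Proof.
move=> cu; rewrite /closing size_cat iotaD find_cat.
have E : {in iota 0 (size u), forall m,
   (ones (take m.+1 (u ++ v)) < twos (take m.+1 (u ++ v)))%N
   = (ones (take m.+1 u) < twos (take m.+1 u))%N}.
  by move=> m; rewrite mem_iota => /= mu; rewrite takel_cat.
by rewrite (eq_in_has E) (eq_in_find E) has_find size_iota -/(closing u) cu.
Qed.

(** * Reading the tree off the word *)

(** Meant for words starting with a 1: the mark is that of the edge which [tree_rec] makes from this
    head letter. *)
Definition letter_mark (w : seq bool) : mark :=
  if (closing (behead w) < size (behead w))%N then plain
  else if odd (unpaired_ones w) then omark else emark.

Section TreePositions.
Variable X : Type.
Implicit Types (w z : seq (X * bool)).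

Fixpoint marked_ones w : seq (mark * X) :=
  if w is (x, c) :: w' then
    if c then (letter_mark (true :: unzip2 w'), x) :: marked_ones w'
    else marked_ones w'
  else [::].

(* The letters giving the subtree above the edge of a 1 placed just before w. *)
Definition above w := take (closing (unzip2 w)) w.

Fixpoint suffix_labelling (cap nu : X -> nat) w : bool :=
  if w is (x, c) :: w' then
    (c ==> (nilp (above w') ==> (nu x <= cap x)%N)
           && all (fun y => y.2 ==> (nu x <= nu y.1)%N) (above w'))
    && suffix_labelling cap nu w'
  else true.

Lemma closing_unzip_cat z w : (closing (unzip2 z) < size z)%N ->
  closing (unzip2 (z ++ w)) = closing (unzip2 z).
Proof. by move=> cz; rewrite /unzip2 map_cat closing_cat // size_map. Qed.

(** Every 1 of [z] is closed inside [z], so its mark is settled before [w] is reached. *)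
Lemma marked_ones_cat z w : unpaired_ones (unzip2 z) = 0%N ->
  marked_ones (z ++ w) = marked_ones z ++ marked_ones w.
Proof.
elim: z => //= -[x []] z /= IH; last exact: IH.
case: eqP => //= cz /IH ->; congr cons; congr pair; rewrite /letter_mark /=.
have cz' : (closing (unzip2 z) < size z)%N.
  by rewrite -(size_map snd) ltn_neqAle closing_le andbT; apply/eqP.
by rewrite closing_unzip_cat // !size_map cz' size_cat ltn_addr.
Qed.

Lemma suffix_labelling_cat cap nu z w : unpaired_ones (unzip2 z) = 0%N ->
  suffix_labelling cap nu (z ++ w) =
  suffix_labelling cap nu z && suffix_labelling cap nu w.
Proof.
elim: z => //= -[x []] z /= IH; last exact: IH.
case: eqP => //= cz /IH ->; rewrite andbA; congr (_ && _ && _); rewrite /above.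
have cz' : (closing (unzip2 z) < size z)%N.
  by rewrite -(size_map snd) ltn_neqAle closing_le andbT; apply/eqP.
by rewrite closing_unzip_cat // takel_cat ?(ltnW cz').
Qed.

Lemma above_split w : (closing (unzip2 w) < size w)%N ->
  exists y, w = above w ++ (y, false) :: drop (closing (unzip2 w)).+1 w.
Proof.
move=> cw; case: w cw => [//|y0 w0]; move: (y0 :: w0) => w cw.
have cw' : (closing (unzip2 w) < size (unzip2 w))%N by rewrite size_map.
have [_ nE] := closing_lt cw'; rewrite (nth_map y0) // in nE.
exists (nth y0 w (closing (unzip2 w))).1; rewrite -nE -surjective_pairing.
by rewrite -drop_nth // cat_take_drop.
Qed.

Lemma unzip2_above w : unzip2 (above w) = take (closing (unzip2 w)) (unzip2 w).
Proof. by rewrite /above /unzip2 map_take. Qed.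

Lemma unpaired_ones_above w : (closing (unzip2 w) < size w)%N ->
  unpaired_ones (unzip2 (above w)) = 0%N.
Proof. by move=> cw; rewrite unzip2_above unpaired_ones_take // size_map. Qed.

Lemma above_size w : ~~ (closing (unzip2 w) < size w)%N -> above w = w.
Proof. by rewrite -leqNgt => ?; rewrite /above take_oversize. Qed.

(** Listing an edge, then what is above it, then what is beside it visits the 1's from left to
    right: the letters enclosed by a matched pair have no unpaired 1, so they split off. *)
Lemma edges_tree_rec n w : (size w <= n)%N -> edges (tree_rec n w) = marked_ones w.
Proof.
elim: n w => [|n IH] [|[x []] w] //=; rewrite !ltnS => ln; last exact: IH.
rewrite /letter_mark /= size_map; case: ifP => cw /=.
  have [y wE] := above_split cw; congr cons.
  rewrite [in RHS]wE marked_ones_cat ?unpaired_ones_above //=.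
  by rewrite !IH // ?size_drop ?size_take_min; lia.
by rewrite cats0 IH.
Qed.

Definition tags (a : rtree X) := unzip2 (edges a).

(** Comparing with every edge above, and not just the next ones, makes the condition at an edge
    depend only on the list of edges above it, which can be read off the word. *)
Fixpoint deep_labelling (cap nu : X -> nat) (a : rtree X) : bool :=
  if a is Edge _ x a1 a2 then
    [&& nilp (edges a1) ==> (nu x <= cap x)%N, all (fun y => nu x <= nu y)%N (tags a1),
        deep_labelling cap nu a1 & deep_labelling cap nu a2]
  else true.

Lemma deep_labellingE cap nu a : is_labelling cap nu a = deep_labelling cap nu a.
Proof.
elim: a => //= m x a1 -> a2 ->.
case: (boolP (deep_labelling cap nu a1)) => [d1|_] /=; last by rewrite !andbF.
rewrite andbA; congr (_ && _); case: a1 d1 => [_|m1 x1 a11 a12] /=.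
  by rewrite andbT.
move=> H; apply/idP/idP; rewrite /tags /=.
  case/andP=> x1x r2.
  (* Stated for the whole tree above [x], so that the induction can pass to the sibling edges; what
     lies above each of them follows by transitivity. *)
  have {H x1x r2}: deep_labelling cap nu (Edge m1 x1 a11 a12) &&
    all (fun y => nu x <= nu y)%N (root_tags (Edge m1 x1 a11 a12)).
    by rewrite /= H x1x r2.
  have -> : (nu x <= nu x1)%N && all (fun y => nu x <= nu y)%N
    (unzip2 (edges a11 ++ edges a12)) =
    all (fun y => nu x <= nu y)%N (tags (Edge m1 x1 a11 a12)) by [].
  elim: (Edge _ _ _ _) => //= m0 y b1 IH1 b2 IH2.
  case/and3P=> /and4P[_ ally db1 db2] xy r2; rewrite /tags /= xy /=.
  rewrite /unzip2 map_cat all_cat; apply/andP; split.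
    by apply: sub_all ally => u; apply: leq_trans.
  by apply: IH2; rewrite db2.
case/andP=> -> /=; move: (a12) => b; elim: b {H} => //= m2 x2 b1 _ b2 IH.
rewrite /unzip2 !map_cat !all_cat /= map_cat all_cat => /and4P[a11x -> b1x b2x] /=.
apply: IH; rewrite /unzip2 !map_cat !all_cat; exact/andP.
Qed.

Lemma marked_ones_tags (P : pred X) w :
  all P (unzip2 (marked_ones w)) = all (fun y => y.2 ==> P y.1) w.
Proof. by elim: w => //= -[x []] w /= ->. Qed.

(** A nonempty word without unpaired 2's starts with a 1. *)
Lemma nilp_marked_ones w : unpaired_twos (unzip2 w) = 0%N ->
  nilp (marked_ones w) = nilp w.
Proof. by case: w => [|[x []] w]. Qed.

Lemma nilp_above w : nilp (marked_ones (above w)) = nilp (above w).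
Proof. by rewrite nilp_marked_ones // unzip2_above unpaired_twos_take. Qed.

Lemma deep_labelling_tree_rec cap nu n w : (size w <= n)%N ->
  deep_labelling cap nu (tree_rec n w) = suffix_labelling cap nu w.
Proof.
elim: n w => [|n IH] [|[x []] w] //=; rewrite !ltnS => ln; last exact: IH.
have ln' k : (size (take k w) <= n)%N by rewrite size_take_min; lia.
rewrite size_map; case: ifP => cw /=.
  rewrite /tags edges_tree_rec // marked_ones_tags -/(above w) nilp_above.
  have [y wE] := above_split cw; rewrite -andbA; congr [&& _, _ & _].
  rewrite [in RHS]wE suffix_labelling_cat ?unpaired_ones_above //=.
  by rewrite !IH ?ln' // ?size_drop; lia.
rewrite /tags edges_tree_rec // marked_ones_tags IH //.
by rewrite -{1 2}(above_size (negbT cw)) nilp_above above_size ?cw // andbT andbA.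
Qed.

Lemma edges_tree w : edges (tree w) = marked_ones w.
Proof. exact: edges_tree_rec. Qed.

Lemma is_labelling_tree cap nu w :
  is_labelling cap nu (tree w) = suffix_labelling cap nu w.
Proof. by rewrite deep_labellingE deep_labelling_tree_rec. Qed.

Lemma marked_ones_nth x0 w :
  marked_ones w = [seq (letter_mark (drop i (unzip2 w)), (nth x0 w i).1)
                  | i <- iota 0 (size w) & (nth x0 w i).2].
Proof.
elim: w => //= -[x c] w IH /=; rewrite (iotaDl 1 0) filter_map.
by case: c; rewrite /= ?drop0 -map_comp IH.
Qed.

Lemma suffix_labelling_nth x0 cap nu w :
  suffix_labelling cap nu w <->
  forall i, (i < size w)%N -> (nth x0 w i).2 ->
    (nilp (above (drop i.+1 w)) -> (nu (nth x0 w i).1 <= cap (nth x0 w i).1)%N)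
    /\ all (fun y => y.2 ==> (nu (nth x0 w i).1 <= nu y.1)%N) (above (drop i.+1 w)).
Proof.
elim: w => //= -[x c] w IH /=; split.
  case/andP=> hd /IH H [|i] /=; last exact: H.
  by rewrite drop0 => _ cT; move: hd; rewrite cT => /andP[/implyP].
move=> H; apply/andP; split; last by apply/IH => i; apply: (H i.+1).
by apply/implyP=> cT; have [] := H 0%N isT cT; rewrite /= drop0 => /implyP-> ->.
Qed.

End TreePositions.

(** * Heights, depths and labellings of positions *)

Lemma heightS w i : (i < size w)%N ->
  height w i.+1 = height w i + (if nth false w i then 1 else -1).
Proof.
move=> iw; rewrite /height (take_nth false) // -cats1 ones_cat twos_cat.
rewrite ones_cons twos_cons -[ones [::]]/0%N -[twos [::]]/0%N.
by case: nth => /=; lia.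
Qed.

Lemma heightE w i : (i <= size w)%N ->
  height w i = (2 * ones (take i w))%N%:Z - i%:Z.
Proof.
by move=> iw; have := ones_twos (take i w); rewrite /height size_takel //; lia.
Qed.

Lemma heightD w i j :
  height w (i + j) = height w i + height (drop i w) j.
Proof. by rewrite /height takeD ones_cat twos_cat; lia. Qed.

Section Fixed.
Variables (N : nat) (alpha beta : N.-tuple bool).

Local Notation b := (nth false beta).
Local Notation h := (height beta).
Local Notation lt_size i := (i < size beta)%N.

Definition depth i := (ones (take i alpha) - ones (take i beta))%N.

(** The upper bound is the position of the 2 matching the 1 at [p], or [N] if there is none; the
    matching 2 itself counts as covered. *)
Definition covers p q :=
  [&& b p, (p <= q)%N & (q <= p.+1 + closing (drop p.+1 beta))%N].

Lemma heightSE i : (i < N)%N -> h i.+1 = h i + (if b i then 1 else -1).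
Proof. by move=> iN; apply: heightS; rewrite size_tuple. Qed.

Lemma letter_ltN i : b i -> (i < N)%N.
Proof. by case: ltnP => // Ni; rewrite nth_default // size_tuple. Qed.

(** After the 1 at [p], the excess of 1's over 2's is the height minus [h p + 1]. Heights are
    constrained only up to [q], so the step at [q] may itself come down to level [h p], as the
    matching 2 does. *)
Lemma coversP p q : (q < N)%N ->
  reflect [/\ b p, (p <= q)%N & forall i, (p < i <= q)%N -> h p < h i] (covers p q).
Proof.
move=> qN; rewrite /covers; case bp: (b p) => /=; last by constructor=> -[].
case: (leqP p q) => pq /=; last by constructor=> -[].
have pN : (p < N)%N := leq_ltn_trans pq qN.
have E j : (ones (take j (drop p.+1 beta)))%:Z - (twos (take j (drop p.+1 beta)))%:Z
         = h (p.+1 + j) - h p - 1.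
  by rewrite -/(height (drop p.+1 beta) j) heightD heightSE // bp; lia.
have -> : (q <= p.+1 + closing (drop p.+1 beta))%N
        = (q - p.+1 <= closing (drop p.+1 beta))%N by lia.
have le : (q - p.+1 <= size (drop p.+1 beta))%N.
  by rewrite size_drop size_tuple; lia.
apply: (iffP (leq_closingP le)) => [H|[_ _ H]].
  split=> // i pi; have := H (i - p.+1)%N; have := E (i - p.+1)%N.
  by rewrite subnKC; lia.
move=> j jq; have := E j; have := H (p.+1 + j)%N.
have [lt|] := ltnP p q; first by lia.
by move=> qp _; rewrite (_ : j = 0%N) ?take0 //; lia.
Qed.

Lemma covers_refl p : b p -> covers p p.
Proof. by move=> bp; rewrite /covers bp leqnn; lia. Qed.

Lemma covers_lt p q : covers p q -> [/\ b p, (p <= q)%N & (p < N)%N].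
Proof. by case/and3P=> bp -> _; rewrite bp letter_ltN. Qed.

Lemma covers_between p q i : covers p q -> (p <= i <= q)%N -> covers p i.
Proof. by rewrite /covers => /and3P[-> pq qc] pi /=; lia. Qed.

Lemma covers_up p : b p -> b p.+1 -> covers p p.+1.
Proof. by move=> bp bp1; rewrite /covers bp; lia. Qed.

(** Take the last index of height at most [v]: as heights change by 1, it lies exactly at [v] and is
    followed by an up step. Such a [p] covers all later positions of the word up to [m]. *)
Lemma last_at_level a m (v : int) : (a <= m <= N)%N -> h a <= v < h m ->
  exists p, [/\ (a <= p < m)%N, h p = v, b p & forall i, (p < i <= m)%N -> v < h i].
Proof.
move=> am hv; have exP : exists i, (a <= i <= m)%N && (h i <= v).
  by exists a; lia.
have ubP i : (a <= i <= m)%N && (h i <= v) -> (i <= m)%N by lia.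
case: (ex_maxnP exP ubP) => p /andP[ap pv] pmax.
have pm : (p < m)%N by have [E|] := eqVneq p m; [move: pv hv; rewrite E | ]; lia.
have gt i : (p < i <= m)%N -> v < h i.
  by move=> pi; have := pmax i; lia.
have := gt p.+1; rewrite heightSE; last by lia.
by exists p; move: H; case: (b p) => H; split=> //; lia.
Qed.

Lemma depth_up i : b i -> (depth i.+1 <= depth i)%N.
Proof.
move=> bi; have iN := letter_ltN bi; rewrite /depth.
rewrite !(take_nth false) ?size_tuple // -!cats1 !ones_cat !ones_cons bi.
by rewrite -[ones [::]]/0%N; case: nth; lia.
Qed.

Lemma depth_down i : (i < N)%N -> ~~ b i -> (depth i <= depth i.+1)%N.
Proof.
move=> iN /negbTE bi; rewrite /depth.
rewrite !(take_nth false) ?size_tuple // -!cats1 !ones_cat !ones_cons bi.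
by rewrite -[ones [::]]/0%N; case: nth; lia.
Qed.

Lemma depth_leN i : (i <= N)%N -> (depth i <= N)%N.
Proof.
move=> iN; rewrite /depth; have := ones_twos (take i alpha).
by rewrite size_takel ?size_tuple //; lia.
Qed.

Lemma depth0 : depth 0 = 0%N.
Proof. by rewrite /depth !take0. Qed.

Definition position_labelling (n : nat -> nat) :=
  [/\ forall q, ~~ b q -> n q = 0%N,
      forall p q, covers p q -> b q -> (n p <= n q)%N
    & forall p, b p -> ~~ b p.+1 -> (n p <= depth p.+1)%N].

(* [depth] decreases along 1's and increases along 2's, so only its values at
   the leaves matter. *)
Lemma labelling_depth n p : position_labelling n -> b p -> (n p <= depth p.+1)%N.
Proof.
case=> _ mono leaf; have [m] := ubnP (N - p).
elim: m p => // m IH p; rewrite ltnS => pm bp.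
have [bp1|] := boolP (b p.+1); last exact: leaf.
apply: leq_trans (mono _ _ (covers_up bp bp1) bp1) _.
apply: leq_trans (depth_up bp1); apply: IH => //.
by have := letter_ltN bp; lia.
Qed.

(** Induction along the covered stretch: at a 1, monotonicity and [labelling_depth] apply; at a 2,
    the previous position gives the bound and [depth] does not decrease. *)
Lemma labelling_depth_cover n p q : position_labelling n -> covers p q ->
  (q < N)%N -> (n p <= depth q)%N && (n p <= depth q.+1)%N.
Proof.
move=> nL; have [_ mono _] := nL; elim: q => [|q IH] c qN.
  have [bp p0 _] := covers_lt c; move: c bp; rewrite (_ : p = 0%N) => [_ bp|]; last by lia.
  by rewrite labelling_depth // (leq_trans _ (depth_up bp)) ?labelling_depth.
have [bq|nbq] := boolP (b q.+1).
  have le := leq_trans (mono _ _ c bq) (labelling_depth nL bq).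
  by rewrite le (leq_trans le) ?depth_up.
suff le : (n p <= depth q.+1)%N by rewrite le (leq_trans le) ?depth_down.
have [bp pq _] := covers_lt c.
have pq' : (p <= q)%N.
  by move: pq nbq; rewrite leq_eqVlt => /predU1P[<-|]; rewrite ?bp.
have c' : covers p q by apply: covers_between c _; rewrite pq' leqnSn.
by case/andP: (IH c' (ltnW qN)).
Qed.

(* [J k q] means that the two boxes of layer [k] at the ends of the [q]-th
   step of the lower path lie in the same strip. *)
Record join_system (J : nat -> nat -> bool) : Prop := JoinSystem {
  join_depth : forall k q, (q < N)%N -> J k q ->
    (k < depth q)%N && (k < depth q.+1)%N;
  join_down : forall k q, (q < N)%N -> J k.+1 q -> J k q;
  join_cover : forall k q, (q < N)%N -> J k q -> exists2 p, covers p q & J k p;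
  join_closed : forall k p q, (q < N)%N -> covers p q -> J k p -> J k q }.

Definition joins (n : nat -> nat) k q :=
  [exists p : 'I_N, covers p q && (k < n p)%N].

Lemma joinsP n k q :
  reflect (exists2 p, covers p q & (k < n p)%N) (joins n k q).
Proof.
apply: (iffP existsP) => [[p /andP[]]|[p c kp]]; first by exists p.
by have [_ _ pN] := covers_lt c; exists (Ordinal pN); rewrite c.
Qed.

Lemma joins_one n k q : position_labelling n -> b q -> joins n k q = (k < n q)%N.
Proof.
case=> _ mono _ bq; apply/joinsP/idP => [[p c kp]|kq].
  exact: leq_trans (mono _ _ c bq).
by exists q; rewrite ?covers_refl.
Qed.

Lemma joins_system n : position_labelling n -> join_system (joins n).
Proof.
move=> nL; split=> [k q qN /joinsP[p c kp]|k q qN /joinsP[p c kp]|k q qN /joinsP[p c kp]|].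
- have /andP[le1 le2] := labelling_depth_cover nL c qN.
  by rewrite (leq_trans kp) // (leq_trans kp).
- by apply/joinsP; exists p => //; apply: ltnW.
- by exists p => //; apply/joinsP; exists p => //; case: (covers_lt c) => /covers_refl.
move=> k p q qN c; have [bp _ _] := covers_lt c.
by rewrite joins_one // => kp; apply/joinsP; exists p.
Qed.

(** In a join system only layers below [depth], hence below [N], occur, which justifies the range of
    the count. *)
Definition join_label (J : nat -> nat -> bool) q :=
  if b q then count (J^~ q) (iota 0 N) else 0%N.

(** A downward closed set is an initial segment, so membership is comparison with its size. *)
Lemma ltn_count_down (P : pred nat) n k : (forall i, P i.+1 -> P i) ->
  (k < count P (iota 0 n))%N = P k && (k < n)%N.
Proof.
move=> Pd; have Pd' i j : P (i + j)%N -> P i.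
  by elim: j => [|j IH]; rewrite ?addn0 // addnS => /Pd.
elim: n k => [|n IH] k; first by rewrite andbF.
rewrite -(addn1 n) iotaD count_cat /= addn0; case Pn: (P n) => /=; last first.
  rewrite addn0 IH addn1 ltnS (leq_eqVlt k); case: eqP => [->|//].
  by rewrite Pn.
have -> : count P (iota 0 n) = n.
  rewrite -[RHS](size_iota 0); apply/eqP; rewrite -all_count; apply/allP => i.
  by rewrite mem_iota => /andP[_ lt]; apply: (Pd' _ (n - i)%N); rewrite subnKC // ltnW.
case: ltnP => [lt|]; rewrite ?andbF // andbT; apply/esym.
by apply: (Pd' _ (n - k)%N); rewrite subnKC //; lia.
Qed.

Lemma ltn_join_label J k q : join_system J -> b q ->
  (k < join_label J q)%N = J k q.
Proof.
move=> sJ bq; have qN := letter_ltN bq; rewrite /join_label bq.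
rewrite ltn_count_down => [|i]; last exact: join_down.
case Jk: (J k q) => //=; have /andP[lt _] := join_depth sJ qN Jk.
exact: leq_trans lt (depth_leN (ltnW qN)).
Qed.

Lemma join_label_labelling J : join_system J -> position_labelling (join_label J).
Proof.
move=> sJ; split=> [q|p q c bq|p bp _]; first by rewrite /join_label => /negbTE->.
  have [bp _ _] := covers_lt c; case E: (join_label J p) => [//|m].
  have: (m < join_label J p)%N by rewrite E.
  rewrite !ltn_join_label //; apply: join_closed c => //; exact: letter_ltN.
case E: (join_label J p) => [//|m]; have: (m < join_label J p)%N by rewrite E.
by rewrite ltn_join_label // => /(join_depth sJ (letter_ltN bp))/andP[].
Qed.

Lemma joins_join_label J k q : join_system J -> (q < N)%N ->
  joins (join_label J) k q = J k q.
Proof.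
move=> sJ qN; apply/joinsP/idP => [[p c]|/(join_cover sJ qN)[p c Jp]].
  by have [bp _ _] := covers_lt c; rewrite ltn_join_label // => /(join_closed sJ qN c).
by exists p => //; have [bp _ _] := covers_lt c; rewrite ltn_join_label.
Qed.

Lemma join_label_joins n J : position_labelling n ->
  (forall k q, (q < N)%N -> J k q = joins n k q) -> forall q, join_label J q = n q.
Proof.
move=> nL JE q; have sJ := joins_system nL; have [n0 _ _] := nL.
have [bq|nbq] := boolP (b q); last by rewrite n0 // /join_label (negbTE nbq).
have -> : join_label J q = join_label (joins n) q.
  rewrite /join_label bq; apply: eq_count => k; apply: JE; exact: letter_ltN.
have key k : (k < join_label (joins n) q)%N = (k < n q)%N.
  by rewrite ltn_join_label // joins_one.
by apply/eqP; rewrite eqn_leq; apply/andP; split;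
  [rewrite leqNgt key ltnn | rewrite leqNgt -key ltnn].
Qed.

End Fixed.

(** * Layers and strips *)

(** For repeated rewriting, where [inE] would go on to unfold membership in [region]. *)
Lemma in_sep (T : finType) (A : {set T}) (P : pred T) x :
  (x \in [set y in A | P y]) = (x \in A) && P x.
Proof. by rewrite inE. Qed.

Section Geometry.
Variables (N : nat) (alpha beta : N.-tuple bool).
Local Notation b := (nth false beta).
Local Notation h := (height beta).
Local Notation depth := (depth alpha beta).
Local Notation region := (region alpha beta).

Lemma height_bounds (w : N.-tuple bool) i : (i <= N)%N -> - i%:Z <= height w i <= i%:Z.
Proof.
move=> iN; rewrite heightE ?size_tuple //; have := ones_twos (take i w).
by rewrite size_takel ?size_tuple //; lia.
Qed.

Lemma col_leN (x : box N) : (col x <= N)%N.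
Proof. by rewrite /col -ltnS ltn_ord. Qed.

(** Meaningful on the region, where the integer is even and non-negative. *)
Definition layer (x : box N) : nat := (absz (row x - 1 - h (col x))%R)./2.

(** The summand [N] undoes the shift of rows in the encoding of boxes. Both [inord] are faithful
    when [i <= N] and [k < depth i]. *)
Definition bx i k : box N :=
  (inord i, inord (absz (N%:Z + h i + 1 + (2 * k)%N%:Z)%R)).

Lemma col_bx i k : (i <= N)%N -> col (bx i k) = i.
Proof. by move=> iN; rewrite /col /= inordK. Qed.

Lemma box_eq (x y : box N) : col x = col y -> row x = row y -> x = y.
Proof.
case: x y => [x1 x2] [y1 y2]; rewrite /col /row /= => c r.
by congr pair; apply: val_inj => //=; lia.
Qed.

Definition strip a e k : {set box N} :=
  [set x in region | (layer x == k) && (a <= col x <= e)%N].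

Definition linked (J : nat -> nat -> bool) (x y : box N) :=
  (layer x == layer y) &&
  [forall q : 'I_N, (minn (col x) (col y) <= q < maxn (col x) (col y))%N ==> J (layer x) q].

Lemma linkedP (J : nat -> nat -> bool) x y :
  reflect (layer x = layer y /\
     forall q, (minn (col x) (col y) <= q < maxn (col x) (col y))%N -> J (layer x) q)
    (linked J x y).
Proof.
apply: (iffP andP) => -[/eqP lE H]; split=> //.
  move=> q qc; have qN : (q < N)%N by have := col_leN x; have := col_leN y; lia.
  by have /implyP := forallP H (Ordinal qN); apply.
by apply/forallP=> q; apply/implyP; apply: H.
Qed.

Lemma linked_equivalence J : {in region & &, equivalence_rel (linked J)}.
Proof.
move=> x y z _ _ _; split; first by apply/linkedP; split=> // q; lia.
move/linkedP=> [lE H]; apply/linkedP/linkedP => -[lE' H'].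
  split=> [|q qc]; first by rewrite -lE.
  have := H q; have := H' q; rewrite -lE.
  by move: (J _ _) => j; lia.
split=> [|q qc]; first by rewrite lE.
by have := H q; have := H' q; rewrite -lE; move: (J _ _) => j; lia.
Qed.

Definition blocks J : {set {set box N}} := equivalence_partition (linked J) region.

Lemma blocks_partition J : partition (blocks J) region.
Proof. exact/equivalence_partitionP/linked_equivalence. Qed.

Lemma blocks_closed J D x y : D \in blocks J -> x \in D -> y \in region ->
  linked J x y -> y \in D.
Proof.
case/imsetP=> z zR -> ; rewrite !in_sep => /andP[xR zx] yR xy; rewrite yR /=.
by have [_ ->] := linked_equivalence J zR xR yR.
Qed.

Lemma blocks_linked J D x y : D \in blocks J -> x \in D -> y \in D -> linked J x y.
Proof.
case/imsetP=> z zR -> ; rewrite !in_sep => /andP[xR zx] /andP[yR zy].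
by have [_ <-] := linked_equivalence J zR xR yR.
Qed.

Definition maximal_run (J : nat -> nat -> bool) a e k :=
  [/\ forall q, (a <= q < e)%N -> J k q,
      (e < N)%N -> ~~ J k e & (0 < a)%N -> ~~ J k a.-1].

(** The ends are the extreme columns that a box [x] of the block reaches through joined steps. A box
    is kept in the conclusion as a starting column for [run_shape], since nothing yet says that
    layer [k] has a box in each column. *)
Lemma blocks_run J D : D \in blocks J -> exists a e k,
  [/\ D = strip a e k, (a <= e <= N)%N, (exists2 x, x \in D & (a <= col x <= e)%N) & maximal_run J a e k].
Proof.
move=> DB; have /imsetP[x xR DE] := DB; set c := col x; set k := layer x.
have cN : (c <= N)%N := col_leN x.
have exA : exists a, (a <= c)%N && [forall q : 'I_N, (a <= q < c)%N ==> J k q].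
  by exists c; rewrite leqnn; apply/forallP=> q; apply/implyP; lia.
have exE : exists e, (c <= e <= N)%N && [forall q : 'I_N, (c <= q < e)%N ==> J k q].
  by exists c; rewrite leqnn cN; apply/forallP=> q; apply/implyP; lia.
have ubE e : (c <= e <= N)%N && [forall q : 'I_N, (c <= q < e)%N ==> J k q] -> (e <= N)%N.
  by case/andP; lia.
case: (ex_minnP exA) => a /andP[ac /forallP aJ] amin.
case: (ex_maxnP exE ubE) => e /andP[ce /forallP eJ] emax.
have {}aJ q : (a <= q < c)%N -> J k q.
  by move=> qa; have qN : (q < N)%N by [lia]; have /implyP := aJ (Ordinal qN); apply.
have {}eJ q : (c <= q < e)%N -> J k q.
  by move=> qa; have qN : (q < N)%N by [lia]; have /implyP := eJ (Ordinal qN); apply.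
exists a, e, k; split; [| by lia | |].
- rewrite DE; apply/setP => y; rewrite !in_sep; case yR: (y \in region) => //=.
  apply/linkedP/andP => [[lE H]|[/eqP lE yc]]; last first.
    split; first by rewrite lE.
    by move=> q qc; have := aJ q; have := eJ q; rewrite -/k -/c in qc *; move: (J _ _) => j; lia.
  split; first by rewrite -lE.
  have yN := col_leN y; apply/andP; split.
    case: (leqP (col y) c) => [yc|]; last by lia.
    apply: amin; rewrite yc; apply/forallP => q; apply/implyP=> qc; apply: H; rewrite -/c; lia.
  case: (leqP c (col y)) => [cy|]; last by lia.
  apply: emax; rewrite cy yN; apply/forallP => q; apply/implyP=> qc; apply: H; rewrite -/c; lia.
- exists x; last by rewrite -/c; lia.
  by rewrite DE inE xR; apply/linkedP; split=> // q; lia.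
split=> [q qa|eN|a0]; first by have := aJ q; have := eJ q; move: (J _ _) => j; lia.
  apply/negP=> Je; suff: (e.+1 <= e)%N by lia.
  apply: emax; apply/andP; split; first by lia.
  apply/forallP=> q; apply/implyP=> qc; have [->//|ne] := eqVneq (q : nat) e.
  by apply: eJ; lia.
apply/negP=> Ja; suff: (a <= a.-1)%N by lia.
apply: amin; apply/andP; split; first by lia.
apply/forallP=> q; apply/implyP=> qc; have [->//|ne] := eqVneq (q : nat) a.-1.
by apply: aJ; lia.
Qed.

Definition strip_shape a e k :=
  [/\ (a <= e <= N)%N, forall i, (a <= i <= e)%N -> (k < depth i)%N
    & forall i, (a <= i <= e)%N -> h a <= h i].

(** [join_depth] spreads the presence of boxes from [i0] to the whole run. The path stays above
    [h a] because each step is covered by a joined 1 of the run, and it returns to [h a] before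
    column [N] because the run cannot be prolonged. *)
Lemma run_shape J a e k : join_system alpha beta J -> (a <= e <= N)%N ->
  (exists2 i, (a <= i <= e)%N & (k < depth i)%N) -> maximal_run J a e k ->
  strip_shape a e k /\ ((e < N)%N -> h e = h a).
Proof.
move=> sJ ae [i0 ia0 kd0] [Jin Jend Jstart].
have kJ q : (a <= q < e)%N -> (k < depth q)%N && (k < depth q.+1)%N.
  by move=> qa; apply: (join_depth sJ); [lia | apply: Jin].
have kd i : (a <= i <= e)%N -> (k < depth i)%N.
  move=> ia; case: (ltngtP i i0) => [lt|lt|->//].
    by have /kJ/andP[] : (a <= i < e)%N by lia.
  have /kJ/andP[_] : (a <= i.-1 < e)%N by lia.
  by rewrite prednK //; lia.
have ha i : (a <= i <= e)%N -> h a <= h i.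
  have [m] := ubnP i; elim: m i => // m IH i; rewrite ltnS => im ia.
  have [->//|ne] := eqVneq i a; have iS : i = i.-1.+1 by lia.
  have iN : (i.-1 < N)%N by lia.
  have Ji : J k i.-1 by apply: Jin; lia.
  have [p c Jp] := join_cover sJ iN Ji; have [bp pi _] := covers_lt c.
  have ap : (a <= p)%N.
    (* A covering 1 left of [a] would also cover step [a.-1] and join it. *)
    case: leqP => // pa; have a0 : (0 < a)%N by lia.
    have ca : covers beta p a.-1 by apply: covers_between c _; lia.
    by have := Jstart a0; rewrite (join_closed sJ _ ca Jp) //; lia.
  have hp : h a <= h p by apply: IH; lia.
  have /coversP := c => /(_ iN) [_ _ gt].
  rewrite iS heightSE //; case bi: (b i.-1).
    by have := IH i.-1; lia.
  have ne' : p != i.-1 by apply/eqP=> E; move: bp; rewrite E bi.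
  by have := gt i.-1; lia.
split; first by [].
move=> eN; have := ha e; have [//|ne] := eqVneq (h e) (h a) => hae.
(* The last 1 leaving level [h a] covers [e], so closure would join step [e]. *)
have [p [pa hp bp gt]] : exists p, [/\ (a <= p < e)%N, h p = h a, b p &
    forall i, (p < i <= e)%N -> h a < h i] by apply: last_at_level; lia.
have c : covers beta p e by apply/coversP => //; split=> // [|i]; rewrite ?hp; [lia | apply: gt].
by have := Jend eN; rewrite (join_closed sJ eN c) // Jin.
Qed.

Hypothesis leab : str_le alpha beta.

(** The order of the two paths makes the truncated subtraction in [depth] exact. *)
Lemma height_depth i : (i <= N)%N -> height alpha i = h i + (2 * depth i)%N%:Z.
Proof.
move=> iN; have := forallP leab (inord i); rewrite inordK // => le.
by rewrite !heightE ?size_tuple // /depth; lia.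
Qed.

Lemma regionP x :
  reflect (exists2 k, (k < depth (col x))%N & row x = h (col x) + 1 + (2 * k)%N%:Z)
          (x \in region).
Proof.
have xN := col_leN x; have hd := height_depth xN.
have ha := height_bounds alpha xN; have hb := height_bounds beta xN.
have hE := heightE (_ : (col x <= size beta)%N); rewrite size_tuple in hE.
have {}hE := hE xN.
rewrite !inE; apply: (iffP andP) => [[na /and4P[c0 rc ev hr]]|[k kd rE]].
  move: na; rewrite c0 rc ev /= => na; have /dvdzP[z zE] := ev.
  (* Here [z] is half of [col x + row x - 1], and the height at [i] is twice the number of 1's minus
     [i]; the difference is half of [row x - 1 - h (col x)]. *)
  by exists (absz (z - (ones (take (col x) beta))%:Z)); lia.
have c0 : (0 < col x)%N.
  by move: kd; case: (col x) => //; rewrite depth0.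
have ev : (2 %| (col x)%:Z + row x - 1)%Z.
  by apply/dvdzP; exists ((ones (take (col x) beta))%:Z + k%:Z); lia.
by rewrite c0 ev /=; lia.
Qed.

Lemma region_row x : x \in region ->
  (layer x < depth (col x))%N /\ row x = h (col x) + 1 + (2 * layer x)%N%:Z.
Proof.
case/regionP=> k kd rE; suff -> : layer x = k by [].
by rewrite /layer rE; lia.
Qed.

Lemma row_bx i k : (i <= N)%N -> (k < depth i)%N ->
  row (bx i k) = h i + 1 + (2 * k)%N%:Z.
Proof.
move=> iN kd; have hd := height_depth iN.
have ha := height_bounds alpha iN; have hb := height_bounds beta iN.
by rewrite /row /= inordK; lia.
Qed.

Lemma bx_region i k : (i <= N)%N -> (k < depth i)%N -> bx i k \in region.
Proof. by move=> iN kd; apply/regionP; exists k; rewrite ?row_bx ?col_bx. Qed.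

Lemma layer_bx i k : (i <= N)%N -> (k < depth i)%N -> layer (bx i k) = k.
Proof. by move=> iN kd; rewrite /layer row_bx // col_bx //; lia. Qed.

Lemma bx_layer x : x \in region -> bx (col x) (layer x) = x.
Proof.
move=> xR; have [ld rE] := region_row xR.
by apply: box_eq; rewrite ?row_bx ?col_bx ?col_leN.
Qed.

Lemma region_eq x y : x \in region -> y \in region ->
  col x = col y -> layer x = layer y -> x = y.
Proof. by move=> xR yR cE lE; rewrite -(bx_layer xR) -(bx_layer yR) cE lE. Qed.

Lemma just_below_layer x y : x \in region -> y \in region ->
  just_below x y = (col x == col y) && (layer y == (layer x).+1).
Proof.
move=> xR yR; have [_ xE] := region_row xR; have [_ yE] := region_row yR.
by rewrite /just_below; case: eqP => //= cE; rewrite xE yE cE; lia.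
Qed.

Lemma bx_strip a e k i : (e <= N)%N -> (k < depth i)%N -> (a <= i <= e)%N ->
  bx i k \in strip a e k.
Proof.
move=> eN kd ie; have iN : (i <= N)%N by lia.
by rewrite inE bx_region // layer_bx // eqxx col_bx.
Qed.

Lemma stripP a e k x : (e <= N)%N ->
  reflect (exists2 i, (a <= i <= e)%N && (k < depth i)%N & x = bx i k)
          (x \in strip a e k).
Proof.
move=> eN; apply: (iffP idP) => [|[i /andP[ie kd] ->]]; last exact: bx_strip.
rewrite inE => /and3P[xR /eqP<- ce]; exists (col x); last by rewrite bx_layer.
by rewrite ce; case: (region_row xR).
Qed.

Definition bx_path a n k := [seq bx i k | i <- iota a.+1 n].

Lemma bx_path_step a n k : (a + n <= N)%N ->
  (forall i, (a <= i <= a + n)%N -> (k < depth i)%N) ->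
  path (@step N) (bx a k) (bx_path a n k).
Proof.
elim: n a => //= n IH a an kd; apply/andP; split; last first.
  by apply: IH => [|i ia]; [lia | apply: kd; lia].
rewrite /step !row_bx ?col_bx ?kd //; try lia.
rewrite heightSE; last by lia.
by case: (b a); lia.
Qed.

Lemma last_bx_path a n k : last (bx a k) (bx_path a n k) = bx (a + n) k.
Proof. by elim: n a => [|n IH] a /=; rewrite ?addn0 // IH addnS. Qed.

Lemma mem_bx_path a n k x : (a + n <= N)%N ->
  (forall i, (a <= i <= a + n)%N -> (k < depth i)%N) ->
  (x \in bx a k :: bx_path a n k) = (x \in strip a (a + n) k).
Proof.
move=> an kd; rewrite -[_ :: _]/[seq bx i k | i <- iota a n.+1].
apply/mapP/stripP => // -[i]; rewrite ?mem_iota.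
  by move=> ia ->; exists i => //; rewrite kd; lia.
by case/andP=> ia _ ->; exists i => //; rewrite mem_iota; lia.
Qed.

Lemma strip_ballot a e k : strip_shape a e k ->
  exists l l' : nat, [/\ ballot_strip l l' (strip a e k),
    (2 * l + l' = e - a)%N & h e = h a + l'%:Z].
Proof.
case=> ae kd ha; have [n en] : exists n, e = (a + n)%N by exists (e - a)%N; lia.
subst e; set v := take n (drop a beta).
have hE : h (a + n) = h a + (ones v)%:Z - (twos v)%:Z by rewrite heightD /height -/v; lia.
have vE : (ones v + twos v = n)%N.
  by rewrite ones_twos size_takel // size_drop size_tuple; lia.
have le : h a <= h (a + n) by apply: ha; lia.
(* Each 2 of the portion [v] cancels a 1, and the excess of 1's is the rise. *)
exists (twos v), (ones v - twos v)%N; split; try lia.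
have sz : size (bx_path a n k) == (2 * twos v + (ones v - twos v))%N.
  by rewrite size_map size_iota; lia.
have anN : (a + n <= N)%N by lia.
apply/existsP; exists (bx a k); apply/existsP; exists (Tuple sz).
rewrite /ballot_path /= bx_path_step // last_bx_path /=; apply/andP; split.
  have ra : row (bx a k) = h a + 1 + (2 * k)%N%:Z by rewrite row_bx ?kd //; lia.
  rewrite ra row_bx ?kd //; last by lia.
  apply/andP; split; last by lia.
  apply/allP => x /mapP[i]; rewrite mem_iota => ia ->.
  have := ha i; rewrite row_bx ?kd //; lia.
apply/eqP/setP => x; rewrite -mem_bx_path //.
by rewrite inE.
Qed.

Lemma strip_weightE (F : fieldType) (t tN : F) l l' (D : {set box N}) :
  ballot_strip l l' D -> (l <= N)%N -> (l' <= N)%N ->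
  strip_weight t tN D = length_weight t tN l l'.
Proof.
move=> bs; rewrite -ltnS => lN; rewrite -ltnS => lN'; rewrite /strip_weight.
case: pickP => [[m m'] /= bm|/(_ (Ordinal lN, Ordinal lN'))/=]; last by rewrite bs.
by have [-> ->] := ballot_strip_inj bm bs.
Qed.

Lemma linked_bx (J : nat -> nat -> bool) i i' k : (i <= i' <= N)%N -> (k < depth i)%N -> (k < depth i')%N ->
  (forall q, (i <= q < i')%N -> J k q) -> linked J (bx i k) (bx i' k).
Proof.
move=> ii ki ki' H; apply/linkedP; rewrite !layer_bx ?col_bx //; try lia.
by split=> // q qi; apply: H; lia.
Qed.

Lemma blocks_strip J D : join_system alpha beta J -> D \in blocks J -> exists a e k,
  [/\ D = strip a e k, strip_shape a e k, maximal_run J a e k & (e < N)%N -> h e = h a].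
Proof.
move=> sJ DB; have [a [e [k [DE ae [x xD xa] run]]]] := blocks_run DB.
exists a, e, k; have [|] := run_shape sJ ae _ run; last by [].
exists (col x) => //; move: xD; rewrite DE inE => /and3P[xR /eqP<- _].
by case: (region_row xR).
Qed.

(** Rule 0 holds since a strip ending before column [N] has equal end heights, so [l'] is 0. Rule Ia
    holds by [join_down]: the steps joined in a strip are joined one layer below. *)
Lemma blocks_Conf J : join_system alpha beta J -> blocks J \in Conf alpha beta.
Proof.
move=> sJ; rewrite inE blocks_partition; apply/and4P; split=> //.
- apply/forall_inP=> D /(blocks_strip sJ)[a [e [k [-> sh _ _]]]].
  have [l [l' [bs ll _]]] := strip_ballot sh; have [ae _ _] := sh.
  have lN : (l < N.+1)%N by lia.
  have lN' : (l' < N.+1)%N by lia.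
  by apply/existsP; exists (Ordinal lN); apply/existsP; exists (Ordinal lN').
- apply/forall_inP=> D /(blocks_strip sJ)[a [e [k [-> sh _ he]]]].
  have [m [m' [bs ll hm]]] := strip_ballot sh; have [ae kd _] := sh.
  apply/forallP=> l; apply/forallP=> l'; apply/implyP=> /andP[bl l0].
  have [_ m'l] := ballot_strip_inj bs bl.
  apply/forall_inP=> x xD; apply/implyP=> /forall_inP H.
  have eE : e = N by apply/eqP; case: ltngtP => // [/he|]; lia.
  have := H (bx e k); rewrite bx_strip ?col_bx ?kd //; try lia.
  by have := col_leN x; lia.
apply/forall_inP=> D DB; apply/forall_inP=> D' D'B; apply/implyP.
case/exists_inP=> x xD /exists_inP[x' x'D] bel.
have [a [e [k [DE sh run _]]]] := blocks_strip sJ DB.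
have [a' [e' [k' [DE' sh' run' _]]]] := blocks_strip sJ D'B.
move: (xD) (x'D); rewrite DE DE' !in_sep => /and3P[xR /eqP lx cx] /and3P[x'R /eqP lx' cx'].
move: bel; rewrite just_below_layer // => /andP[/eqP cE /eqP lE].
have kE : k' = k.+1 by lia.
have [ae' kd' _] := sh'; have [Jin' _ _] := run'.
apply/forall_inP=> y'; rewrite inE => /and3P[y'R /eqP ly' cy'].
have kd : (k < depth (col y'))%N by have := kd' _ cy'; lia.
have yR : bx (col y') k \in region by rewrite bx_region ?col_leN.
apply/exists_inP; exists (bx (col y') k).
  rewrite -DE; apply: (blocks_closed DB xD yR); apply/linkedP.
  rewrite layer_bx ?col_leN // col_bx ?col_leN //; split=> // q qc.
  have qN : (q < N)%N by have := col_leN x; have := col_leN y'; lia.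
  by rewrite lx; apply: (join_down sJ qN); rewrite -kE; apply: Jin'; lia.
by rewrite just_below_layer // col_bx ?col_leN // layer_bx ?col_leN // eqxx ly' kE /=.
Qed.

(** The depth conditions ensure that both boxes lie in the region; otherwise [pblock] could return
    the empty set on both sides. *)
Definition joined (C : {set {set box N}}) k q :=
  [&& (k < depth q)%N, (k < depth q.+1)%N
    & pblock C (bx q k) == pblock C (bx q.+1 k)].

(** * Strips of a configuration and their join system *)

Section Configuration.
Variable C : {set {set box N}}.
Hypothesis CConf : C \in Conf alpha beta.

Lemma Conf_partition : partition C region.
Proof. by move: CConf; rewrite inE => /and4P[]. Qed.

Let coverC : cover C = region.
Proof. by have /and3P[/eqP] := Conf_partition. Qed.

Let trivC : trivIset C.
Proof. by have /and3P[] := Conf_partition. Qed.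

Lemma Conf_region D x : D \in C -> x \in D -> x \in region.
Proof. by move=> DC xD; rewrite -coverC; apply/bigcupP; exists D. Qed.

Lemma Conf_pblock D x : D \in C -> x \in D -> pblock C x = D.
Proof. exact: def_pblock. Qed.

Lemma Conf_mem x : x \in region -> pblock C x \in C /\ x \in pblock C x.
Proof. by rewrite -coverC => xC; rewrite pblock_mem // mem_pblock. Qed.

Lemma Conf_rule_Ia D D' x x' y' : D \in C -> D' \in C -> x \in D -> x' \in D' ->
  just_below x x' -> y' \in D' -> exists2 y, y \in D & just_below y y'.
Proof.
move: CConf; rewrite inE => /and4P[_ _ _ /forall_inP H] DC D'C xD x'D bel y'D.
have /implyP := forall_inP (H D DC) D' D'C.
case/(_ _)/forall_inP/(_ _ y'D)/exists_inP => [|y yD bel']; last by exists y.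
by apply/exists_inP; exists x => //; apply/exists_inP; exists x'.
Qed.

(* By induction on the layer: Rule Ia makes all boxes of a strip rest on one and
   the same strip as soon as one of them is above layer 0. *)
Lemma Conf_layer D x y : D \in C -> x \in D -> y \in D -> layer x = layer y.
Proof.
suff key k : forall D' x' y', D' \in C -> x' \in D' -> y' \in D' ->
    layer x' = k -> layer y' = k.
  by move=> DC xD yD; rewrite (key _ _ _ _ DC xD yD (erefl _)).
move=> {D x y}; have below x : x \in region -> (0 < layer x)%N ->
    bx (col x) (layer x).-1 \in region /\ just_below (bx (col x) (layer x).-1) x.
  move=> xR x0; have [lt _] := region_row xR.
  have lt' : ((layer x).-1 < depth (col x))%N by lia.
  have xR' := bx_region (col_leN x) lt'; split=> //.
  by rewrite just_below_layer // col_bx ?col_leN // layer_bx ?col_leN // eqxx /=; lia.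
elim: k => [|k IH] D x y DC xD yD lx; have xR := Conf_region DC xD;
  have yR := Conf_region DC yD.
  case ly: (layer y) => [//|m]; have [|y'R bel] := below y yR; first by rewrite ly.
  have [DC' y'D] := Conf_mem y'R.
  have [z zD zx] := Conf_rule_Ia DC' DC y'D yD bel xD.
  by move: zx; rewrite just_below_layer ?(Conf_region DC' zD) // lx andbF.
have [|x'R bel] := below x xR; first by rewrite lx.
have [DC' x'D] := Conf_mem x'R.
have [z zD zy] := Conf_rule_Ia DC' DC x'D xD bel yD.
have lz : layer z = k.
  have [lt _] := region_row xR; rewrite lx in lt.
  by apply: (IH _ _ _ DC' x'D zD); rewrite lx layer_bx ?col_leN // ltnW.
by move: zy; rewrite just_below_layer ?(Conf_region DC' zD) // lz => /andP[_ /eqP].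
Qed.

(** The boxes of a ballot strip have consecutive columns and, by [Conf_layer], one layer, which
    determines them. The ballot condition becomes minimality of [h a], and Rule 0 excludes a rise
    before column [N]. *)
Lemma Conf_strip D : D \in C -> exists a e k,
  [/\ D = strip a e k, strip_shape a e k & (e < N)%N -> h e = h a].
Proof.
move=> DC; have := CConf; rewrite inE => /and4P[_ /forall_inP/(_ D DC)].
case/existsP=> l /existsP[l' bs] /forall_inP/(_ D DC)/forallP/(_ l)/forallP/(_ l') r0 _.
have /existsP[x /existsP[p /andP[/and3P[pp /allP pmin /eqP pl] /eqP DE]]] := bs.
have cE := step_col pp; have sp := size_tuple p; rewrite sp in cE.
set a := col x; set n := (2 * l + l')%N; set k := layer x.
have pD i : (i <= n)%N -> nth x (x :: p) i \in D.
  by move=> iN; rewrite DE inE mem_nth //= sp.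
have pE i : (i <= n)%N -> nth x (x :: p) i = bx (a + i) k.
  move=> iN; rewrite -(bx_layer (Conf_region DC (pD _ iN))) cE //.
  by rewrite (Conf_layer DC (pD _ iN) (pD 0%N _)).
have kd i : (a <= i <= a + n)%N -> (k < depth i)%N.
  move=> ia; have /pD : (i - a <= n)%N by lia.
  rewrite pE; last by lia.
  rewrite subnKC; last by lia.
  move=> iD; have iR := Conf_region DC iD; have [] := region_row iR.
  rewrite (Conf_layer DC iD (pD 0%N _)) //= -/k col_bx //.
  have := cE (i - a)%N; have := col_leN (nth x (x :: p) (i - a)); rewrite -/a -/n; lia.
have anN : (a + n <= N)%N by rewrite -cE ?col_leN.
have rowE i : (a <= i <= a + n)%N -> row (bx i k) = h i + 1 + (2 * k)%N%:Z.
  by move=> ia; rewrite row_bx ?kd //; lia.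
have xE : x = bx a k by rewrite -[LHS]/(nth x (x :: p) 0) pE // addn0.
have lE : last x p = bx (a + n) k by rewrite (last_nth x) sp pE.
exists a, (a + n)%N, k; split.
- apply/setP => y; rewrite DE inE; apply/(nthP x)/stripP => //.
    case=> i; rewrite /= sp ltnS => iN <-; exists (a + i)%N; last by rewrite pE.
    by rewrite kd; lia.
  case=> i /andP[ia _] ->; exists (i - a)%N; first by rewrite /= sp; lia.
  by rewrite pE ?subnKC //; lia.
- split=> // [|i ia]; first by lia.
  have [->//|ne] := eqVneq i a.
  have : bx i k \in p.
    have := mem_nth x (_ : (i - a).-1 < size p)%N; rewrite sp.
    have := pE (i - a)%N; rewrite (_ : (i - a = (i - a).-1.+1)%N) /=; last by lia.
    rewrite (_ : (a + (i - a).-1.+1)%N = i); last by lia.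
    by move=> ->; last lia; apply; lia.
  by move/pmin; rewrite {1}xE !rowE; lia.
move=> eN; move: pl; rewrite lE xE !rowE; try lia.
case l0: (0 < l')%N; last by lia.
move: r0; rewrite bs l0 /= => /forall_inP/(_ (bx (a + n) k)).
rewrite -{1}lE DE inE mem_last => /(_ isT)/implyP; rewrite col_bx // => H.
have : (a + n)%N == N; last by lia.
apply: H; apply/forall_inP=> y; rewrite inE => /(nthP x)[i]; rewrite /= sp => iN <-.
by rewrite cE -/a; lia.
Qed.

Lemma joined_strip a e k q : strip a e k \in C -> strip_shape a e k ->
  (a <= q < e)%N -> joined C k q.
Proof.
move=> SC [ae kd _] qa; rewrite /joined !kd //=; try lia.
rewrite !(Conf_pblock SC) //; apply: bx_strip; rewrite ?kd; lia.
Qed.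

Lemma joined_inv k q : (q < N)%N -> joined C k q -> exists a e,
  [/\ strip a e k \in C, strip_shape a e k, (e < N)%N -> h e = h a & (a <= q < e)%N].
Proof.
move=> qN /and3P[kq kq1 /eqP pE].
have qR := bx_region (ltnW qN) kq; have q1R := bx_region qN kq1.
have [DC qD] := Conf_mem qR; have [_ q1D] := Conf_mem q1R; rewrite -pE in q1D.
have [a [e [k' [DE sh he]]]] := Conf_strip DC.
move: qD q1D; rewrite DE !in_sep !layer_bx ?col_bx //; try lia.
case/and3P=> _ /eqP kk qa /and3P[_ _ q1a]; rewrite -kk in DE sh.
by exists a, e; split=> //; [rewrite -DE | lia].
Qed.

Lemma joined_system : join_system alpha beta (joined C).
Proof.
split=> [k q _ /and3P[-> ->]//|k q qN|k q qN|k p q qN].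
- case/and3P=> kq kq1 /eqP pE; rewrite /joined (ltnW kq) (ltnW kq1) /=.
  have qR := bx_region (ltnW qN) kq; have q1R := bx_region qN kq1.
  have qR' := bx_region (ltnW qN) (ltnW kq); have q1R' := bx_region qN (ltnW kq1).
  have [DC qD] := Conf_mem qR; have [_ q1D] := Conf_mem q1R; rewrite -pE in q1D.
  have [D'C q'D] := Conf_mem qR'.
  have bel : just_below (bx q k) (bx q k.+1).
    have qN' := ltnW qN; have kq' := ltnW kq.
    by rewrite just_below_layer // !col_bx // !layer_bx // !eqxx.
  (* The strip of [bx q k] touches the strip above it from below, hence also contains the box below
     [bx q.+1 k.+1]. *)
  have [y yD bel'] := Conf_rule_Ia D'C DC q'D qD bel q1D.
  have yR := Conf_region D'C yD; move: bel'; rewrite just_below_layer //.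
  rewrite col_bx // layer_bx // => /andP[/eqP cy /eqP ly].
  have yE : y = bx q.+1 k.
    have kq1' := ltnW kq1; apply: region_eq; rewrite ?col_bx ?layer_bx //.
    by case: ly.
  by rewrite -yE (Conf_pblock D'C yD).
- move=> Jq; have [a [e [SC sh he qa]]] := joined_inv qN Jq; have [ae kd ha] := sh.
  have [bq|nbq] := boolP (b q); first by exists q; rewrite ?covers_refl.
  have h1 : h q.+1 = h q - 1 by rewrite heightSE // (negbTE nbq).
  (* Step [q] descends inside the strip, so the 1 that it matches starts at level [h q.+1] and lies
     in the same strip. *)
  have lev : h a <= h q.+1 < h q by have := ha q.+1; lia.
  have [p [pa hp bp gt]] : exists p, [/\ (a <= p < q)%N, h p = h q.+1, b p &
      forall i, (p < i <= q)%N -> h q.+1 < h i].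
    have [p [pa hp bp gt]] : exists p, [/\ (a <= p < q)%N, h p = h a, b p &
      forall i, (p < i <= q)%N -> h a < h i] by apply: last_at_level; lia.
    have [p' [? ? ? ?]] : exists p', [/\ (p <= p' < q)%N, h p' = h q.+1, b p' &
      forall i, (p' < i <= q)%N -> h q.+1 < h i] by apply: last_at_level; lia.
    by exists p'; split=> //; lia.
  exists p; last by apply: joined_strip SC sh _; lia.
  by apply/coversP => //; split=> // [|i]; rewrite ?hp; [lia | apply: gt].
move=> c Jp; have [bp pq pN] := covers_lt c.
have [a [e [SC sh he pa]]] := joined_inv pN Jp; have [ae kd ha] := sh.
apply: joined_strip SC sh _; rewrite (leq_trans _ pq) /=; last by lia.
have /coversP := c => /(_ qN)[_ _ gt].
(* A strip ending at [e <= q] would have [h e = h a <= h p], while covering gives [h p < h e]. *)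
case: leqP => // eq; have := gt e; have := ha p; have := he; lia.
Qed.

(** Along joined steps [pblock C] is constant, so linked boxes share a strip; conversely all steps
    inside a strip are joined. *)
Lemma blocks_joined : blocks (joined C) = C.
Proof.
rewrite -[RHS](equivalence_partition_pblock Conf_partition).
apply: eq_in_imset => x xR; apply/setP => y; rewrite !in_sep.
case yR: (y \in region) => //=; have [DC xD] := Conf_mem xR.
apply/linkedP/idP => [[lE H]|yD].
  have key n i k : (i + n <= N)%N -> (forall j, (i <= j <= i + n)%N -> (k < depth j)%N) ->
      (forall q, (i <= q < i + n)%N -> joined C k q) ->
      pblock C (bx i k) = pblock C (bx (i + n) k).
    elim: n => [|n IH] iN kd Jin; first by rewrite addn0.
    rewrite IH; try lia; last first.
    - by move=> q qi; apply: Jin; lia.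
    - by move=> j ji; apply: kd; lia.
    have /and3P[_ _ /eqP->] : joined C k (i + n) by apply: Jin; lia.
    by rewrite addnS.
  have [lx _] := region_row xR; have [ly _] := region_row yR.
  have xN := col_leN x; have yN := col_leN y.
  have kd i : (minn (col x) (col y) <= i <= maxn (col x) (col y))%N -> (layer x < depth i)%N.
    move=> ic; have [->//|nx] := eqVneq i (col x).
    have [->|ny] := eqVneq i (col y); first by rewrite lE.
    by have /and3P[->] : joined C (layer x) i by apply: H; lia.
  suff -> : pblock C x = pblock C y by have [] := Conf_mem yR.
  rewrite -(bx_layer xR) -(bx_layer yR) -lE.
  case: (leqP (col x) (col y)) => [le|lt].
    rewrite (key (col y - col x)%N); [by rewrite subnKC | by lia | |].
      by move=> j jc; apply: kd; lia.
    by move=> j jc; apply: H; lia.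
  have le := ltnW lt; apply/esym; rewrite (key (col x - col y)%N); [by rewrite subnKC | by lia | |].
    by move=> j jc; apply: kd; lia.
  by move=> j jc; apply: H; lia.
have [a [e [k [DE sh he]]]] := Conf_strip DC; have SC := DC; rewrite DE in SC.
split=> [|q qc]; first exact: Conf_layer DC xD yD.
move: xD yD; rewrite DE !in_sep => /and3P[_ /eqP-> xa] /and3P[_ _ ya].
by apply: (joined_strip SC sh); lia.
Qed.

End Configuration.

Lemma joined_blocks J k q : join_system alpha beta J -> (q < N)%N ->
  joined (blocks J) k q = J k q.
Proof.
move=> sJ qN; have BC := blocks_Conf sJ; apply/idP/idP.
  case/and3P=> kq kq1 /eqP pE.
  have [DC qD] := Conf_mem BC (bx_region (ltnW qN) kq).
  have [_ q1D] := Conf_mem BC (bx_region qN kq1); rewrite -pE in q1D.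
  have /linkedP[_] := blocks_linked DC qD q1D.
  by have qN' := ltnW qN; rewrite layer_bx // !col_bx //; apply; lia.
move=> Jq; have /andP[kq kq1] := join_depth sJ qN Jq; rewrite /joined kq kq1 /=.
have [DC qD] := Conf_mem BC (bx_region (ltnW qN) kq); rewrite eq_sym.
apply/eqP; apply: (Conf_pblock BC DC); apply: (blocks_closed DC qD) => //.
  exact: bx_region.
by apply: linked_bx => // [|r rq]; [lia | rewrite (_ : r = q) //; lia].
Qed.

End Geometry.

(** * Labellings of the tree of a path *)

(** The default letter accounts for the empty word, whose [closing] is 0 too. *)
Lemma closing_eq0 w : (closing w == 0)%N = ~~ nth false w 0.
Proof.
case: w => [|c w] //=; apply/idP/idP => [/eqP c0|nc].
  apply/negP=> cT; suff: (1 <= closing (c :: w))%N by rewrite c0.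
  by apply/leq_closingP => // -[|[|]] //=; rewrite ?take0 cT.
by rewrite /closing /= take0; case: c nc.
Qed.

Lemma marked_ones_unzip2 X (w : seq (X * bool)) :
  unzip2 (marked_ones w) = unzip1 [seq y <- w | y.2].
Proof. by elim: w => //= -[x []] w /= ->. Qed.

Section TreeOfPath.
Variables (N : nat) (alpha beta : N.-tuple bool).
Local Notation b := (nth false beta).

Let word : seq ('I_N * bool) := [seq (i, tnth beta i) | i <- enum 'I_N].

Let word_size : size word = N.
Proof. by rewrite size_map size_enum_ord. Qed.

Let word_letters : unzip2 word = beta.
Proof. by rewrite /unzip2 -map_comp map_tnth_enum. Qed.

Let word_nth x0 (i : 'I_N) : nth x0 word i = (i, b i).
Proof.
by rewrite (nth_map i) ?size_enum_ord // nth_ord_enum (tnth_nth false).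
Qed.

Lemma mem_treeA p : (p \in unzip2 (edges (treeA beta))) = b p.
Proof.
rewrite edges_tree marked_ones_unzip2 filter_map /unzip1 -map_comp map_id mem_filter.
by rewrite mem_enum andbT /= (tnth_nth false).
Qed.

Lemma big_treeA (R : comPzSemiRingType) (F : mark -> 'I_N -> R) :
  \prod_(e <- edges (treeA beta)) F e.1 e.2
  = \prod_(i < N | b i) F (letter_mark (drop i beta)) i.
Proof.
rewrite edges_tree -/word; case: (posnP N) => [N0|N0].
  rewrite (size0nil (_ : size word = 0%N)) ?word_size // big_nil big_pred0 // => i.
  by have := ltn_ord i; lia.
pose i0 := Ordinal N0; rewrite (marked_ones_nth (i0, false)) big_map big_filter.
rewrite word_letters word_size.
have -> : iota 0 N = index_iota 0 N by rewrite /index_iota subn0.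
rewrite big_mkord.
by apply: eq_big => [i|i _]; rewrite word_nth.
Qed.

(** The positions covered by [p] exceed those read by [above] only by [p] itself, where the
    inequality is trivial, and by the matching 2, which carries no edge. *)
Lemma is_labelling_treeA (cap nu : 'I_N -> nat) :
  is_labelling cap nu (treeA beta) <->
  (forall p q : 'I_N, covers beta p q -> b q -> (nu p <= nu q)%N)
  /\ (forall p : 'I_N, b p -> ~~ b p.+1 -> (nu p <= cap p)%N).
Proof.
rewrite is_labelling_tree -/word; case: (posnP N) => [N0|N0].
  rewrite (size0nil (_ : size word = 0%N)) ?word_size //; split=> // _.
  by split=> p; have := ltn_ord p; lia.
pose x0 := (Ordinal N0, false).
have leaf (p : 'I_N) : nilp (above (drop p.+1 word)) = ~~ b p.+1.
  rewrite /nilp size_take_min /unzip2 map_drop -/(unzip2 word) word_letters.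
  rewrite size_drop word_size; case: (ltnP p.+1 N) => pN; last first.
    by rewrite nth_default ?size_tuple //; lia.
  rewrite -[p.+1 in RHS]addn0 -nth_drop -closing_eq0.
  have := closing_le (drop p.+1 beta); rewrite size_drop size_tuple; lia.
have cov (p : 'I_N) : b p ->
  (forall q : 'I_N, covers beta p q -> b q -> (nu p <= nu q)%N) <->
  all (fun y => y.2 ==> (nu p <= nu y.1)%N) (above (drop p.+1 word)).
  move=> bp; have -> : above (drop p.+1 word) =
    take (closing (drop p.+1 beta)) (drop p.+1 word).
    by rewrite /above /unzip2 map_drop -/(unzip2 word) word_letters.
  set c := closing _; have cs := closing_le (drop p.+1 beta).
  rewrite size_drop size_tuple -/c in cs.
  have sz : size (take c (drop p.+1 word)) = c.
    by rewrite size_takel // size_drop word_size.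
  split=> [H|/(all_nthP x0) H q].
    apply/(all_nthP x0) => j; rewrite sz => jc; rewrite nth_take // nth_drop.
    have pj : (p.+1 + j < N)%N by lia.
    rewrite (word_nth x0 (Ordinal pj)); apply/implyP => /= bj.
    by apply: (H (Ordinal pj)) => //; rewrite /covers bp -/c /=; lia.
  rewrite /covers bp -/c /= => /andP[pq qc] bq.
  have [->//|ne] := eqVneq p q; have {ne}pq : (p < q)%N by rewrite ltn_neqAle ne pq.
  (* Position [p.+1 + c], if inside the word, holds the matching 2, whereas [q] holds a 1. *)
  have qc' : (q < p.+1 + c)%N.
    rewrite ltn_neqAle qc andbT; apply/eqP=> qE.
    have qN := ltn_ord q.
    have [|_] := @closing_lt (drop p.+1 beta); first by rewrite size_drop size_tuple -/c; lia.
    by rewrite nth_drop -/c -qE (set_nth_default false) ?size_tuple // bq.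
  have := H (q - p.+1)%N; rewrite sz nth_take; last by lia.
  rewrite nth_drop subnKC // word_nth /= bq; apply; lia.
split=> [/(suffix_labelling_nth x0) H|[Hc Hl]].
  rewrite word_size in H.
  have {}H (p : 'I_N) : b p -> (~~ b p.+1 -> (nu p <= cap p)%N) /\
      forall q : 'I_N, covers beta p q -> b q -> (nu p <= nu q)%N.
    by move=> bp; have := H p; rewrite word_nth /= leaf cov //; apply.
  split=> [p q c bq|p bp]; last by case: (H p bp).
  by have [bp _ _] := covers_lt c; case: (H p bp) => _; apply.
apply/(suffix_labelling_nth x0) => i; rewrite word_size => iN.
rewrite (word_nth x0 (Ordinal iN)) /= => bi.
split; first by rewrite (leaf (Ordinal iN)); apply: Hl.
by apply/(cov (Ordinal iN)) => // q; apply: Hc.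
Qed.

Definition label_at (nu : {ffun 'I_N -> 'I_N.+1}) q : nat :=
  oapp (fun i => nat_of_ord (nu i)) 0%N (insub q).

Lemma label_at_ord nu (p : 'I_N) : label_at nu p = nu p.
Proof. by rewrite /label_at valK. Qed.

Lemma label_at_ge nu q : (N <= q)%N -> label_at nu q = 0%N.
Proof. by move=> Nq; rewrite /label_at insubN // -leqNgt. Qed.

Lemma labellingsP nu :
  nu \in labellings alpha beta <-> position_labelling alpha beta (label_at nu).
Proof.
rewrite inE; split=> [/andP[/is_labelling_treeA[Hc Hl] /forallP H0]|[H0 Hc Hl]].
  split=> [q nq|p q c bq|p bp nbp].
  - case: (ltnP q N) => [qN|]; last exact: label_at_ge.
    have := H0 (Ordinal qN); rewrite mem_treeA /= (negbTE nq) /= => /eqP.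
    by rewrite (label_at_ord nu (Ordinal qN)) => ->.
  - have [bp _ pN] := covers_lt c; have qN := letter_ltN bq.
    by rewrite (label_at_ord nu (Ordinal qN)) (label_at_ord nu (Ordinal pN)); apply: Hc.
  have pN := letter_ltN bp; rewrite (label_at_ord nu (Ordinal pN)).
  exact: (Hl (Ordinal pN)).
apply/andP; split.
  apply/is_labelling_treeA; split=> [p q c bq|p bp nbp]; rewrite -!label_at_ord.
    exact: Hc.
  exact: Hl.
apply/forallP=> p; rewrite mem_treeA; case bp: (b p) => //=.
by apply/eqP/val_inj; rewrite /= -label_at_ord H0 ?bp.
Qed.

End TreeOfPath.

(** * Weights *)

Section Weights.
Variables (F : fieldType) (t tN : F).
Hypothesis tN0 : tN != 0.

Definition mark_weight (m : mark) : F :=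
  match m with
  | plain => t ^+ 2
  | omark => - tN ^+ 2
  | emark => - (t ^+ 2 / tN ^+ 2)
  end.

Lemma prod_mark_weight (I : Type) (s : seq (mark * I)) (n : I -> nat) :
  \prod_(e <- s) mark_weight e.1 ^+ n e.2 =
  t ^+ (2 * \sum_(e <- s | e.1 == plain) n e.2)
  * (- tN ^+ 2) ^+ (\sum_(e <- s | e.1 == omark) n e.2)
  * (- (t ^+ 2 / tN ^+ 2)) ^+ (\sum_(e <- s | e.1 == emark) n e.2).
Proof.
elim: s => [|[m x] s IH]; first by rewrite !big_nil !mulr1.
rewrite !big_cons IH /=; case: m => /=.
- by rewrite -exprM mulnDr exprD !mulrA.
- by rewrite exprD mulrCA.
by rewrite exprD -!mulrA mulrCA.
Qed.

(* The tail of a path with u unpaired 1's and no unpaired 2 contributes this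
   factor: consecutive o- and e-weights multiply to t^2. *)
Definition unpaired_weight u : F :=
  if odd u then - t ^+ u.-1 * tN ^+ 2 else t ^+ u.

Lemma unpaired_weightS u : unpaired_weight u.+1 =
  mark_weight (if odd u.+1 then omark else emark) * unpaired_weight u.
Proof.
rewrite /unpaired_weight /=; case: u => [|u] /=; first by rewrite expr0 mulN1r mulr1.
case: (odd u) => /=; first by rewrite !mulNr mulrC.
(* An e-weight meets the o-weight to its right: [tN ^+ 2] cancels because [tN] is nonzero. *)
by rewrite !mulNr mulrN opprK mulrACA mulVf ?expf_neq0 // mulr1 -exprD.
Qed.

Definition suffix_weight (w : seq bool) : F :=
  \prod_(0 <= i < size w | nth false w i) mark_weight (letter_mark (drop i w)).

Lemma suffix_weight_cons c w : suffix_weight (c :: w) =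
  (if c then mark_weight (letter_mark (c :: w)) else 1) * suffix_weight w.
Proof.
rewrite /suffix_weight big_mkcond big_nat_recl //= -big_mkcond.
by congr (_ * _); apply: eq_bigr.
Qed.

(** Each matched 1 contributes [t ^+ 2]. An unpaired 1 put in front gets the mark given by the
    parity of the new number of unpaired 1's, as [unpaired_weightS] requires. *)
Lemma suffix_weightE w :
  suffix_weight w = t ^+ (2 * (ones w - unpaired_ones w)) * unpaired_weight (unpaired_ones w)
  /\ (unpaired_ones w <= ones w)%N.
Proof.
elim: w => [|c w [IH le]]; first by rewrite /suffix_weight big_nil mulr1.
rewrite suffix_weight_cons IH ones_cons; case: c => /=; last by rewrite mul1r add0n.
rewrite /letter_mark /=; have := closing_le w; rewrite leq_eqVlt.
case: eqP => [-> _|_ /= cw]; last first.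
  rewrite cw !add0n subSn // mulnS exprD -mulrA; split=> //; lia.
rewrite ltnn !add1n subSS unpaired_weightS /=; split=> //.
by rewrite mulrCA.
Qed.

Section Path.
Variables (N : nat) (alpha beta : N.-tuple bool).
Hypothesis leab : str_le alpha beta.
Local Notation b := (nth false beta).
Local Notation h := (height beta).
Local Notation depth := (depth alpha beta).
Local Notation wt i := (mark_weight (letter_mark (drop i beta))).

Lemma prod_suffix_weight a : (a <= N)%N ->
  \prod_(a <= i < N | b i) wt i = suffix_weight (drop a beta).
Proof.
move=> aN; rewrite -{1}[a]add0n big_addn /suffix_weight size_drop size_tuple.
by apply: eq_big => [i|i _]; rewrite ?nth_drop ?drop_drop addnC.
Qed.

(** The witness [c] is the number of 1's in the stretch; the height equation lets it be recovered
    from the length of a strip. *)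
Lemma prod_plain a n : (a + n <= N)%N ->
  (forall i, (a <= i < a + n)%N -> b i -> letter_mark (drop i beta) = plain) ->
  exists c, \prod_(a <= i < a + n | b i) wt i = t ^+ (2 * c)
    /\ h (a + n) = h a + (2 * c)%N%:Z - n%:Z.
Proof.
elim: n => [|n IH] aN pl; first by exists 0%N; rewrite addn0 big_geq //; split=> //; lia.
have [|i ia|c [cE hE]] := IH; [by lia | by apply: pl; lia |].
rewrite addnS big_mkcond big_nat_recr -?big_mkcond ?leq_addr //= cE.
rewrite heightSE; last by lia.
case bi: (b (a + n)); last by exists c; rewrite mulr1; split=> //; lia.
exists c.+1; rewrite pl ?bi //; last by lia.
by rewrite mulnS addnC exprD; split=> //; lia.
Qed.

(** Before column [N] the strip has [l' = 0] and all its 1's are plain: an unpaired one would cover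
    [e], giving [h i < h e = h a]. At column [N] the 1's are those of a suffix, to which
    [suffix_weightE] applies. *)
Lemma strip_weight_prod a e k : strip_shape alpha beta a e k ->
  ((e < N)%N -> h e = h a) ->
  strip_weight t tN (strip alpha beta a e k) = \prod_(a <= i < e | b i) wt i.
Proof.
move=> sh he; have [ae kd ha] := sh; have [l [l' [bs ll hl]]] := strip_ballot leab sh.
rewrite (strip_weightE t tN bs); try lia.
have [n en] : exists n, e = (a + n)%N by exists (e - a)%N; lia.
have [eN|eN] := ltnP e N.
  have l0 : l' = 0%N by have := he eN; lia.
  subst e; have [|i ia bi|c [-> hE]] := @prod_plain a n; first by lia.
    rewrite /letter_mark /=; case: ifP => // /negbT cl.
    have iN : (i < N)%N by lia.
    have dE : behead (drop i beta) = drop i.+1 beta by rewrite -drop1 drop_drop add1n.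
    rewrite dE size_drop size_tuple in cl.
    have /coversP : covers beta i (a + n).
      by rewrite /covers bi /=; lia.
    by case/(_ eN)=> _ _ /(_ (a + n)%N); have := ha i; have := he eN; lia.
  by rewrite /length_weight l0 /=; congr (t ^+ _); lia.
have {eN}eN : e = N by lia.
have aN : (a + n)%N = N by lia.
clear en; subst e; rewrite prod_suffix_weight; last by lia.
set v := drop a beta; have vs : size v = n by rewrite size_drop size_tuple; lia.
(* Being ballot, the suffix has no unpaired 2, so its unpaired 1's number exactly its rise [l']. *)
have u0 : unpaired_twos v = 0%N.
  apply/eqP; rewrite -leqn0; apply/unpaired_twos_leP=> i; rewrite addn0.
  have [iv|/ltnW iv] := leqP i (size v).
    by have := ha (a + i)%N; rewrite heightD /height -/v; lia.
  rewrite take_oversize //; have := ha (a + n)%N.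
  by rewrite heightD /height -/v -vs take_size; lia.
have [-> _] := suffix_weightE v; have := unpaired_ones_twos v; rewrite u0 addn0.
have := ones_twos v; have : h N = h a + (ones v)%:Z - (twos v)%:Z.
  have <- := congr1 h aN; rewrite heightD {2}/height -/v -vs take_size; lia.
move=> hN v1 v2; have -> : unpaired_ones v = l' by lia.
have -> : (ones v - l')%N = l by lia.
rewrite /length_weight /unpaired_weight; case: ifP => l'odd; last by rewrite exprD.
have l'0 : (0 < l')%N by case: (l') l'odd.
have -> : (2 * l + l' - 1 = 2 * l + l'.-1)%N by lia.
by rewrite exprD !mulNr mulrN mulrA.
Qed.

Lemma prod_strip (G : box N -> F) a e k : (a <= e <= N)%N ->
  (forall i, (a <= i <= e)%N -> (k < depth i)%N) ->
  \prod_(x in strip alpha beta a e k) G x = \prod_(a <= i < e.+1) G (bx beta i k).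
Proof.
move=> ae kd; have [n en] : exists n, e = (a + n)%N by exists (e - a)%N; lia.
subst e; rewrite /index_iota (_ : ((a + n).+1 - a)%N = n.+1); last by lia.
rewrite -(big_map (fun i => bx beta i k) xpredT G) big_uniq; last first.
  rewrite map_inj_in_uniq ?iota_uniq // => i j.
  rewrite !mem_iota => ia ja /(congr1 (@col N)).
  by rewrite !col_bx //; lia.
by case/andP: ae => _ anN; apply: eq_bigl => x; rewrite -mem_bx_path.
Qed.

Lemma prod_region (G : box N -> F) :
  \prod_(x in region alpha beta) G x =
  \prod_(i < N.+1) \prod_(0 <= k < depth i) G (bx beta i k).
Proof.
rewrite (partition_big (fun x : box N => x.1) xpredT) //=.
apply: eq_bigr => i _; have iN : (i <= N)%N by rewrite -ltnS.
rewrite -(big_map (fun k => bx beta i k) xpredT G) big_uniq /=; last first.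
  rewrite map_inj_in_uniq ?iota_uniq // => k k'; rewrite !mem_index_iota /= => kd kd'.
  by move/(congr1 (layer beta)); rewrite !(layer_bx leab iN).
apply: eq_bigl => x; apply/andP/mapP => [[xR /eqP xi]|[k]].
  have [ld _] := region_row leab xR; exists (layer beta x).
    by rewrite mem_index_iota -xi.
  by rewrite -[in LHS](bx_layer leab xR) -xi.
rewrite mem_index_iota /= => kd ->; rewrite (bx_region leab) //; split=> //.
by apply/eqP/val_inj; rewrite /= inordK.
Qed.

(** Double counting: each joined step at a 1 puts its weight on its left box. Multiplying by strips
    gives the strip weights; by columns, the weight of letter [i] occurs once for each of the [n i]
    layers using it. *)
Lemma prod_blocks n : position_labelling alpha beta n ->
  \prod_(D in blocks alpha beta (joins beta n)) strip_weight t tN D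
  = \prod_(i < N | b i) wt i ^+ n i.
Proof.
move=> nL; have sJ := joins_system nL; set J := joins beta n.
pose G (x : box N) := if b (col x) && J (layer beta x) (col x) then wt (col x) else 1.
transitivity (\prod_(x in region alpha beta) G x).
  rewrite (set_partition_big _ (blocks_partition alpha beta J)).
  apply: eq_bigr => D /(blocks_strip leab sJ)[a [e [k [-> sh [Jin Jend _] he]]]].
  have [ae kd _] := sh; rewrite -/J in Jin Jend; rewrite strip_weight_prod // prod_strip //.
  rewrite big_nat_recr; last by lia.
  have GE i : (a <= i <= e)%N -> G (bx beta i k) = if b i && J k i then wt i else 1.
    by move=> ia; rewrite /G (layer_bx leab) ?kd ?col_bx //; lia.
  rewrite /= GE; last by lia.
  (* The last box of a strip carries no weight: step [e] is not joined, or [e = N] is past the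
     word. *)
  have -> : b e && J k e = false.
    case: (ltnP e N) => [/Jend/negbTE->|eN]; first by rewrite andbF.
    by rewrite nth_default ?size_tuple.
  rewrite mulr1 big_mkcond; apply: eq_big_nat => i ia; rewrite GE; last by lia.
  by rewrite Jin // andbT.
rewrite prod_region big_ord_recr /= [X in _ * X]big1 => [|k _]; last first.
  by rewrite /G col_bx // nth_default ?size_tuple.
rewrite mulr1 [RHS]big_mkcond /=; apply: eq_bigr => i _.
have iN : (i <= N)%N by rewrite ltnW.
have GE k : (0 <= k < depth i)%N -> G (bx beta i k) = if b i && (k < n i)%N then wt i else 1.
  move=> kd; rewrite /G (layer_bx leab iN) // col_bx //.
  by case bi: (b i) => //=; rewrite /J (joins_one _ nL).
rewrite (eq_big_nat _ _ GE); case bi: (b i) => /=; last by rewrite big1.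
have le : (n i <= depth i)%N.
  exact: leq_trans (labelling_depth nL bi) (depth_up alpha bi).
rewrite -big_mkcond -(big_nat_widen 0 _ _ xpredT) // prodr_const_nat subn0 //.
Qed.

Lemma labellings_weight (nu : {ffun 'I_N -> 'I_N.+1}) :
  \prod_(i < N | b i) wt i ^+ label_at nu i =
  t ^+ (2 * label_sum beta nu plain)
  * (- tN ^+ 2) ^+ label_sum beta nu omark
  * (- (t ^+ 2 / tN ^+ 2)) ^+ label_sum beta nu emark.
Proof.
rewrite -(prod_mark_weight (edges (treeA beta)) (fun p => nu p)).
rewrite (big_treeA beta (fun m p => mark_weight m ^+ nu p)).
by apply: eq_bigr => i _; rewrite label_at_ord.
Qed.

End Path.
End Weights.

Lemma eq_blocks N (alpha beta : N.-tuple bool) J J' :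
  (forall k q, (q < N)%N -> J k q = J' k q) -> blocks alpha beta J = blocks alpha beta J'.
Proof.
move=> JE; apply: eq_in_imset => x _; apply/setP => y; rewrite !in_sep; congr (_ && _).
by congr (_ && _); apply: eq_forallb => q; rewrite JE.
Qed.

(** The inner variable is evaluated at [y], so ['X%:P] is a nonzero polynomial with value [y]. *)
Lemma alg_indep_neq0 (F : fieldType) (x y : F) : alg_indep x y -> y != 0.
Proof.
move=> /(_ 'X%:P) H; apply/eqP=> y0; have /eqP : ('X%:P : {poly {poly int}}) = 0.
  by apply: H; rewrite map_polyC /= hornerC map_polyX hornerX.
by rewrite polyC_eq0 polyX_eq0.
Qed.

(** * The bijection between labellings and configurations *)

Section Bijection.
Variables (N : nat) (alpha beta : N.-tuple bool).
Hypothesis leab : str_le alpha beta.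

Definition configuration (nu : {ffun 'I_N -> 'I_N.+1}) : {set {set box N}} :=
  blocks alpha beta (joins beta (label_at nu)).

Definition labelling (C : {set {set box N}}) : {ffun 'I_N -> 'I_N.+1} :=
  [ffun q : 'I_N => inord (join_label beta (joined alpha beta C) q)].

Lemma label_at_labelling C q :
  label_at (labelling C) q = join_label beta (joined alpha beta C) q.
Proof.
have le : (join_label beta (joined alpha beta C) q <= N)%N.
  rewrite /join_label; case: ifP => // _.
  by rewrite -[leqRHS](size_iota 0) count_size.
case: (ltnP q N) => qN; last first.
  by rewrite label_at_ge // /join_label nth_default ?size_tuple.
by rewrite (label_at_ord _ (Ordinal qN)) ffunE inordK.
Qed.

Lemma configurationK nu : nu \in labellings alpha beta ->
  configuration nu \in Conf alpha beta /\ labelling (configuration nu) = nu.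
Proof.
move/labellingsP=> nL; have sJ := joins_system nL; split; first exact: blocks_Conf.
apply/ffunP=> q; apply/val_inj; rewrite /= -!label_at_ord label_at_labelling.
rewrite (join_label_joins nL) // => k r rN; exact: joined_blocks.
Qed.

Lemma labellingK C : C \in Conf alpha beta ->
  labelling C \in labellings alpha beta /\ configuration (labelling C) = C.
Proof.
move=> CC; have sJ := joined_system leab CC; split.
  apply/labellingsP; have [H0 Hc Hl] := join_label_labelling sJ.
  by split=> *; rewrite !label_at_labelling; auto.
rewrite -[RHS](blocks_joined leab CC); apply: eq_blocks => k q qN.
rewrite -(joins_join_label _ sJ qN) /joins; apply: eq_existsb => p.
by rewrite label_at_labelling.
Qed.

End Bijection.

Theorem theorem27 (F : fieldType) (t tN : F) (N : nat)
  (alpha beta : N.-tuple bool) :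
  alg_indep t tN -> str_le alpha beta ->
  QA t tN alpha beta = RA t tN alpha beta.
Proof.
move=> /alg_indep_neq0 tN0 leab; rewrite /QA /RA.
rewrite (reindex_onto (configuration alpha beta) (labelling alpha beta)) /=; last first.
  by move=> C /(labellingK leab)[].
apply: eq_big => [nu|nu /andP[CC /eqP nuE]].
  (* The index condition left by [reindex_onto] singles out exactly the labellings. *)
  apply/andP/idP => [[CC /eqP<-]|/(configurationK leab)[-> ->]//].
  by case: (labellingK leab CC).
rewrite -(labellings_weight t tN) prod_blocks //.
by apply/labellingsP; rewrite -nuE; case: (labellingK leab CC).
Qed.
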